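(* Let $X_{11},\dots,X_{1n_1}$ and $X_{21},\dots,X_{2n_2}$ be two independent random samples from densities $g_1$ and $g_2$ satisfying the density ratio model $g_1(x)=\exp(\alpha_0+\beta_0'h(x))\,g_2(x)$ with true parameter $\theta_0=(\alpha_0,\beta_0')'$, and assume that the matrix $A$ (defined in the context) is nonsingular. Assume that $\theta_0$ lies in a compact set. Let the penalty function be $J(\beta)=\sum_{j=1}^{d}|\beta_j|^q$ with $q>1$, and suppose that the regularization parameters $\lambda_n>0$ satisfy $\lambda_n/\sqrt{n}\to\lambda_0\ge 0$, where $n=n_1+n_2$. If $n\to\infty$ in such a way that $n_1/n_2\to\rho_1\in(0,\infty)$, then there exists a unique maximizer $\hat\theta^\lambda$ of the penalized empirical log-likelihood $l_p(\theta)=l(\theta)-\lambda_nJ(\beta)$ such that $\|\hat\theta^\lambda-\theta_0\|=O_p(n^{-1/2})$. In particular, if $\lambda_0=0$, then $\hat\theta^\lambda$ is consistent for $\theta_0$.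
   Context: Density ratio model: $g_1,g_2$ are unknown probability densities on $\mathbb{R}$ with cumulative distribution functions $G_1,G_2$; $h:\mathbb{R}\to\mathbb{R}^d$ is a known function; $\alpha\in\mathbb{R}$, $\beta=(\beta_1,\dots,\beta_d)'\in\mathbb{R}^d$, and $\theta=(\alpha,\beta')'\in\mathbb{R}^{d+1}$. A prime denotes transpose. $\theta_0=(\alpha_0,\beta_0')'$ denotes the true value of $\theta$. Empirical log-likelihood (profiled over $G_2$), where $x_{ij}$ are the observed values of $X_{ij}$: $$l(\theta)=-\sum_{i=1}^{2}\sum_{j=1}^{n_i}\log\Big[1+\tfrac{n_1}{n_2}\exp(\alpha+\beta'h(x_{ij}))\Big]+\sum_{j=1}^{n_1}(\alpha+\beta'h(x_{1j})).$$ Penalized empirical log-likelihood: $l_p(\theta)=l(\theta)-\lambda_nJ(\beta)$, a function of $\theta\in\mathbb{R}^{d+1}$ (the intercept $\alpha$ is not penalized). Matrix $A$: with $\rho_1=\lim n_1/n_2$ and $w(x)=\dfrac{\exp(\alpha_0+\beta_0'h(x))}{1+\rho_1\exp(\alpha_0+\beta_0'h(x))}$, put $$A_{11}=\int_{-\infty}^{\infty}w\,dG_2,\qquad A_{21}=\int_{-\infty}^{\infty}w\,h\,dG_2\in\mathbb{R}^d,\qquad A_{22}=\int_{-\infty}^{\infty}w\,hh'\,dG_2,$$ $$A=\begin{pmatrix} A_{11} & A_{21}' \\ A_{21} & A_{22} \end{pmatrix},$$ where these integrals are assumed to be finite. *)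

(* Defs.v *)
From HB Require Import structures.
From mathcomp Require Import all_boot all_order all_algebra.
From mathcomp Require Import all_classical all_reals all_analysis.
Import Order.TTheory GRing.Theory Num.Theory.
Import numFieldNormedType.Exports.
Set Implicit Arguments.
Unset Strict Implicit.
Unset Printing Implicit Defensive.
Local Open Scope classical_set_scope.
Local Open Scope ring_scope.

(* The library norm on matrices is the sup norm. *)
Definition enorm (R : realType) (n : nat) (v : 'cV[R]_n) : R :=
  Num.sqrt (\sum_(i < n) v i 0 ^+ 2).

Definition is_density (R : realType) (g : R -> R)
    (G : probability (measurableTypeR R) R) : Prop :=
  [/\ measurable_fun setT g,
      (forall x, 0 <= g x) &
      forall B : set (measurableTypeR R), measurable B ->
        G B = (\int[lebesgue_measure]_(x in B) (g x)%:E)%E].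

(* Subfamilies are covered by taking B i = setT for the other indices. *)
Definition mutually_independent (dsp : measure_display)
    (T : measurableType dsp) (R : realType) (P : probability T R)
    (I : finType) (X : I -> T -> R) : Prop :=
  forall B : I -> set (measurableTypeR R), (forall i, measurable (B i)) ->
    P (\bigcap_(i in [set: I]) (X i @^-1` B i)) =
    (\prod_(i : I) P (X i @^-1` B i))%E.

Definition pooled (T : Type) (m n : nat) (X1 : 'I_m -> T) (X2 : 'I_n -> T)
    (i : 'I_m + 'I_n) : T :=
  match i with inl j => X1 j | inr j => X2 j end.

Definition two_samples (dsp : measure_display) (T : measurableType dsp)
    (R : realType) (P : probability T R)
    (G1 G2 : probability (measurableTypeR R) R) (m n : nat)
    (X1 : 'I_m -> {RV P >-> measurableTypeR R})
    (X2 : 'I_n -> {RV P >-> measurableTypeR R}) : Prop :=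
  [/\ (forall j B, measurable B -> distribution P (X1 j) B = G1 B),
      (forall j B, measurable B -> distribution P (X2 j) B = G2 B) &
      mutually_independent P (fun i => pooled X1 X2 i : T -> R)].

(* Y_k = O_p(a_k) as k tends to infinity; meant for random variables Y_k and
   positive rates a_k. *)
Definition bigO_in_probability (dsp : measure_display)
    (T : measurableType dsp) (R : realType) (P : probability T R)
    (Y : nat -> T -> R) (a : nat -> R) : Prop :=
  forall eps : R, 0 < eps ->
    exists2 M : R, 0 < M &
      \forall k \near \oo, (P [set t | (M * a k < `|Y k t|)%R] <= eps%:E)%E.

Definition consistent (dsp : measure_display)
    (T : measurableType dsp) (R : realType) (P : probability T R) (n : nat)
    (thetahat : nat -> T -> 'cV[R]_n) (theta0 : 'cV[R]_n) : Prop :=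
  forall eps : R, 0 < eps ->
    P [set t | eps < enorm (thetahat k t - theta0)] @[k --> \oo] --> 0%E.

Definition measurable_vector (dsp : measure_display)
    (T : measurableType dsp) (R : realType) (n : nat)
    (Z : T -> 'cV[R]_n) : Prop :=
  forall i : 'I_n, measurable_fun [set: T] (fun t => Z t i 0).

(* theta = (alpha, beta')' lives in dimension 1 + d: its first block is the
   intercept alpha, its second block is beta. *)
Definition intercept (R : realType) (d : nat) (theta : 'cV[R]_(1 + d)) : R :=
  usubmx theta 0 0.

Definition slope (R : realType) (d : nat) (theta : 'cV[R]_(1 + d)) : 'cV[R]_d :=
  dsubmx theta.

Definition linpred (R : realType) (d : nat) (h : R -> 'cV[R]_d)
    (theta : 'cV[R]_(1 + d)) (x : R) : R :=
  intercept theta + ((slope theta)^T *m h x) 0 0.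

Definition loglik (R : realType) (d : nat) (h : R -> 'cV[R]_d) (n1 n2 : nat)
    (x1 : 'I_n1 -> R) (x2 : 'I_n2 -> R) (theta : 'cV[R]_(1 + d)) : R :=
  - (\sum_(j < n1) ln (1 + n1%:R / n2%:R * expR (linpred h theta (x1 j)))
     + \sum_(j < n2) ln (1 + n1%:R / n2%:R * expR (linpred h theta (x2 j))))
  + \sum_(j < n1) linpred h theta (x1 j).

Definition bridge_penalty (R : realType) (d : nat) (q : R)
    (beta : 'cV[R]_d) : R :=
  \sum_(j < d) `|beta j 0| `^ q.

Definition penalized_loglik (R : realType) (d : nat) (h : R -> 'cV[R]_d)
    (q lam : R) (n1 n2 : nat) (x1 : 'I_n1 -> R) (x2 : 'I_n2 -> R)
    (theta : 'cV[R]_(1 + d)) : R :=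
  loglik h x1 x2 theta - lam * bridge_penalty q (slope theta).

Definition maximizer (R : realType) (U : Type) (f : U -> R) (u : U) : Prop :=
  forall v : U, f v <= f u.

Definition weight (R : realType) (d : nat) (h : R -> 'cV[R]_d)
    (theta0 : 'cV[R]_(1 + d)) (rho1 : R) (x : R) : R :=
  expR (linpred h theta0 x) / (1 + rho1 * expR (linpred h theta0 x)).

Definition A11 (R : realType) (d : nat) (h : R -> 'cV[R]_d)
    (theta0 : 'cV[R]_(1 + d)) (rho1 : R)
    (G2 : probability (measurableTypeR R) R) : 'M[R]_1 :=
  (\int[G2]_x weight h theta0 rho1 x)%:M.

Definition A21 (R : realType) (d : nat) (h : R -> 'cV[R]_d)
    (theta0 : 'cV[R]_(1 + d)) (rho1 : R)
    (G2 : probability (measurableTypeR R) R) : 'cV[R]_d :=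
  \col_(i < d) \int[G2]_x (weight h theta0 rho1 x * h x i 0).

Definition A22 (R : realType) (d : nat) (h : R -> 'cV[R]_d)
    (theta0 : 'cV[R]_(1 + d)) (rho1 : R)
    (G2 : probability (measurableTypeR R) R) : 'M[R]_d :=
  \matrix_(i < d, j < d)
    \int[G2]_x (weight h theta0 rho1 x * (h x *m (h x)^T) i j).

Definition matA (R : realType) (d : nat) (h : R -> 'cV[R]_d)
    (theta0 : 'cV[R]_(1 + d)) (rho1 : R)
    (G2 : probability (measurableTypeR R) R) : 'M[R]_(1 + d) :=
  block_mx (A11 h theta0 rho1 G2) (A21 h theta0 rho1 G2)^T
           (A21 h theta0 rho1 G2) (A22 h theta0 rho1 G2).

(* Needed for matA to be meaningful: the library integral is total. *)
Definition finite_A_integrals (R : realType) (d : nat) (h : R -> 'cV[R]_d)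
    (theta0 : 'cV[R]_(1 + d)) (rho1 : R)
    (G2 : probability (measurableTypeR R) R) : Prop :=
  [/\ G2.-integrable setT (fun x => (weight h theta0 rho1 x)%:E),
      (forall i : 'I_d, G2.-integrable setT
         (fun x => (weight h theta0 rho1 x * h x i 0)%:E)) &
      forall i j : 'I_d, G2.-integrable setT
         (fun x => (weight h theta0 rho1 x * (h x *m (h x)^T) i j)%:E)].

(* Main.v *)
Require Import Defs.
From HB Require Import structures.
From mathcomp Require Import all_boot all_order all_algebra.
From mathcomp Require Import ring lra.
From mathcomp Require Import all_classical all_reals all_analysis.
From mathcomp Require Import measurable_realfun.
Import Order.TTheory GRing.Theory Num.Theory.
Import numFieldNormedType.Exports.
Local Open Scope classical_set_scope.
Local Open Scope ring_scope.
Set Implicit Arguments.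
Unset Strict Implicit.
Unset Printing Implicit Defensive.

(** The penalized log-likelihood is strictly concave and coercive, hence has
    exactly one maximizer, and this maximizer depends measurably on the data.
    The rate follows from a single comparison of the objective at the maximizer
    and at theta0; neither a Taylor expansion nor a preliminary consistency
    argument is needed.

    Let z = (1, h(x)')' and rho = n1 / n2.  On the pooled sample, l is the
    log-likelihood of a logistic regression of the sample label b in {0, 1}
    on z: an observation contributes b eta - ln (1 + rho e^eta), where
    eta = theta'z.  Everything rests on one scalar inequality, valid on the
    whole line ([log_mgf_gap]): for 0 < p < 1,
<<
      p (1 - p) s^2 / (2 (1 + |s|)) <= ln (1 - p + p e^s) - p s.
>>
    Summed over the observations, with u = theta - theta0, S the score at
    theta0 and p the success probability of the logistic regression, it gives
    ([loglik_gap])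
<<
      l(theta) <= l(theta0) + S'u - sum of p (1 - p) (u'z)^2 / (2 (1 + |u'z|)).
>>
    Strict positivity of the gap yields strict concavity in the intercept,
    and the penalty provides it in the slope ([penalized_loglik_supergradients]).

    For the rate, let r and |z| denote l1 norms.  As 1 + |u'z| is at most
    (1 + r) (1 + |z|), the last sum is at least a multiple of u'Mu / (1 + r),
    where M is the sum over the second sample of the matrices v z z' for a
    weight v making their entries bounded.  If l_p(theta0) <= l_p(theta), and
    M / n is bounded below, then r / (1 + r) is at most a constant times
    (|S| + lambda) / n ([rate_bound]).  Three facts finish the proof.
    - S is exactly centred, because G1 is the tilt of G2 by e^eta and the
      weight rho equals n1 / n2; its variance is at most a multiple of n times
      the trace of A.  Hence S = O_p(sqrt n) by Chebyshev ([score_tail]).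
    - M / n2 is close to its mean by Chebyshev ([info_tail]), and this mean is
      positive definite, since a vector in its kernel is orthogonal to z almost
      everywhere and so lies in the kernel of A ([info_positive_definite]).
    - lambda = O(sqrt n).

    Consistency is a consequence of the rate. *)

(** * Scalar inequalities *)

Lemma ge_from_derivative (R : realType) (f df : R -> R) (s : R) :
  0 <= s -> (forall x : R, 0 <= x -> is_derive x 1 f (df x)) ->
  (forall x : R, 0 <= x -> 0 <= df x) -> f 0 <= f s.
Proof.
move=> s0 fdf df0.
apply: (@ger0_derive1_ndecr R f 0 s) => //.
- by move=> x; rewrite in_itv/= => /andP[/ltW x0 _]; have [] := fdf x x0.
- move=> x; rewrite in_itv/= => /andP[/ltW x0 _].
  by rewrite derive1E (@derive_val _ _ _ _ _ _ _ (fdf x x0)) df0.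
- apply: continuous_in_subspaceT => x; rewrite inE/= in_itv/= => /andP[x0 _].
  by apply: differentiable_continuous; apply/derivable1_diffP; have [] := fdf x x0.
Qed.

(** The difference of the two sides vanishes at 0.  Its derivative is p (1 - p)
    times (e^s - 1) / (1 - p + p e^s) - (s^2 + 2 s) / (2 (1 + s)^2), and
    s / (1 + s) separates the two terms: the first is at least 1 - e^-s. *)
Lemma log_mgf_gap_pos (R : realType) (p s : R) : 0 < p < 1 -> 0 <= s ->
  p * (1 - p) * (s ^+ 2 / (2 * (1 + s))) <= ln (1 - p + p * expR s) - p * s.
Proof.
move=> /andP[p0 p1] s0.
rewrite -subr_ge0.
pose f (x : R) := ln (1 - p + p * expR x) - p * x - p * (1 - p) * (x ^+ 2 / (2 * (1 + x))).
pose df (x : R) := p * (1 - p) * ((expR x - 1) / (1 - p + p * expR x) -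
   (x ^+ 2 + 2 * x) / (2 * (1 + x) ^+ 2)).
have f00 : f 0 = 0 by rewrite /f expR0 expr0n /= !mul0r !mulr0 mulr1 subrK ln1 !subr0.
rewrite -{1}f00.
apply: (@ge_from_derivative _ f df) => // x x0.
  have D0 : 0 < 1 - p + p * expR x by rewrite addr_gt0 ?subr_gt0 ?mulr_gt0 ?expR_gt0.
  have D1 : 2 * (1 + x) != 0 by lra.
  have := is_derive1_ln D0 => ?.
  have dinv : is_derive x 1 (fun y => (2 * (1 + y))^-1) (- (2 * (1 + x)) ^- 2 * 2).
    apply: (@is_deriveV R (fun y => 2 * (1 + y)) x 2 1) => //.
    by apply: is_derive_eq; rewrite /GRing.scale/=; ring.
  have dln : is_derive x 1 (fun y => ln (1 - p + p * expR y))
     ((1 - p + p * expR x)^-1 * (p * expR x)).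
    apply: (@is_derive1_comp R (@ln R) (fun y => 1 - p + p * expR y)).
    by apply: is_derive_eq; rewrite /GRing.scale/=; ring.
  rewrite /f; apply: is_derive_eq.
  rewrite /df /GRing.scale/=; field.
  by rewrite gt_eqF//=; lra.
rewrite /df; apply: mulr_ge0; first by rewrite mulr_ge0// ?subr_ge0 ltW.
rewrite subr_ge0.
have e1 : 1 + x <= expR x by exact: expR_ge1Dx.
have eD : 1 - p + p * expR x <= expR x by nra.
have D0 : 0 < 1 - p + p * expR x by rewrite addr_gt0 ?subr_gt0 ?mulr_gt0 ?expR_gt0.
apply: (@le_trans _ _ (x / (1 + x))).
  rewrite ler_pdivrMr; last by nra.
  rewrite (_ : x / (1 + x) * _ = 2 * x * (1 + x)); last by field; lra.
  by nra.
apply: (@le_trans _ _ ((expR x - 1) / expR x)).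
  rewrite ler_pdivrMr; last by lra.
  rewrite mulrAC ler_pdivlMr; last by lra.
  by nra.
rewrite ler_wpM2l//; first lra.
by rewrite lef_pV2 ?posrE ?expR_gt0.
Qed.

(** The left-hand side is quadratic near 0 and linear at infinity, as is the
    log-moment generating function of a centred Bernoulli variable on the right;
    a purely quadratic bound would fail.  Exchanging p with 1 - p turns s into
    - s. *)
Lemma log_mgf_gap (R : realType) (p s : R) : 0 < p < 1 ->
  p * (1 - p) * (s ^+ 2 / (2 * (1 + `|s|))) <= ln (1 - p + p * expR s) - p * s.
Proof.
move=> p01; have [s0|s0] := leP 0 s.
  by rewrite ger0_norm//; exact: log_mgf_gap_pos.
rewrite ltr0_norm//.
have q01 : 0 < 1 - p < 1 by lra.
have ms0 : 0 <= - s by lra.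
have := log_mgf_gap_pos q01 ms0; rewrite sqrrN opprB addrCA subrr addr0 [_ * p]mulrC.
move=> /le_trans; apply.
have D0 : 0 < 1 - p + p * expR s by rewrite addr_gt0 ?mulr_gt0 ?expR_gt0//; lra.
rewrite (_ : p + (1 - p) * expR (- s) = expR (- s) * (1 - p + p * expR s)).
  by rewrite lnM ?posrE ?expR_gt0// expRK; lra.
by rewrite mulrDr mulrCA -expRD addNr expR0; ring.
Qed.

(** The weak form is Young's inequality.  Applying it to the square root of x and
    squaring gains the positive term q (q - 1) (sqrt x - 1)^2.  Where the bound
    for the square root is negative, so is the left-hand side. *)
Lemma bernoulli_strict (R : realType) (q x : R) : 1 < q -> 0 <= x -> x != 1 ->
  1 + q * (x - 1) < x `^ q.
Proof.
move=> q1 x0 xN1.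
have weak (y : R) : 0 <= y -> 1 + q * (y - 1) <= y `^ q.
  move=> y0.
  have q0 : 0 < q by lra.
  have r0 : 0 < (1 - q^-1)^-1 by rewrite invr_gt0 subr_gt0 invf_lt1.
  have /= := conjugate_powR y0 ler01 q0 r0.
  rewrite invrK subrKC => /(_ erefl).
  rewrite powR1 mul1r mulr1 -(ler_pM2l q0) mulrDr mulrCA divff ?gt_eqF//.
  rewrite mulrBr divff ?gt_eqF//; lra.
pose y := Num.sqrt x.
have y0 : 0 <= y by rewrite sqrtr_ge0.
have xy : x = y ^+ 2 by rewrite sqr_sqrtr.
have yN1 : y != 1 by apply: contra xN1 => /eqP y1; rewrite xy y1 expr1n.
have -> : x `^ q = (y `^ q) ^+ 2.
  by rewrite xy -[y ^+ 2]powR_mulrn// -powRrM mulrC powRrM powR_mulrn// powR_ge0.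
have w := weak y y0.
have y1 : 0 < (y - 1) ^+ 2 by rewrite exprn_even_gt0//= subr_eq0.
rewrite xy.
have [B0|B0] := leP 0 (1 + q * (y - 1)).
  apply: (@lt_le_trans _ _ ((1 + q * (y - 1)) ^+ 2)); last by rewrite ler_sqr ?nnegrE ?powR_ge0.
  rewrite -subr_gt0 (_ : _ - _ = q * (q - 1) * (y - 1) ^+ 2); last by ring.
  by apply: mulr_gt0 => //; apply: mulr_gt0; lra.
apply: (@lt_le_trans _ _ 0); last exact: sqr_ge0.
have y_lt1 : y < 1 by rewrite ltNge; apply/negP => ?; nra.
have : 0 <= q * (y * (1 - y)) by rewrite !mulr_ge0//; lra.
rewrite (_ : q * (y * (1 - y)) = q * (y - 1) - q * (y ^+ 2 - 1)); last by ring.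
lra.
Qed.

(** For x != 0 the slope is that of the derivative, and the claim is Bernoulli's
    inequality at y / x; for x = 0 the minimum is strict. *)
Lemma powR_norm_tangent (R : realType) (q x : R) : 1 < q ->
  exists s, forall y, y != x -> `|x| `^ q + s * (y - x) < `|y| `^ q.
Proof.
move=> q1; have q0 : 0 < q by lra.
have [->|x0] := eqVneq x 0.
  exists 0 => y y0; rewrite normr0 powR0 ?gt_eqF// mul0r addr0.
  by rewrite powR_gt0 ?normr_gt0.
exists (q * `|x| `^ q / x) => y yx.
have xq0 : 0 < `|x| `^ q by rewrite powR_gt0 ?normr_gt0.
pose z := y / x.
have yE : y = z * x by rewrite /z divfK.
have z1 : z != 1 by apply: contra yx => /eqP z1; rewrite yE z1 mul1r.
have -> : `|x| `^ q + q * `|x| `^ q / x * (y - x) = (1 + q * (z - 1)) * `|x| `^ q.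
  by rewrite yE; field.
rewrite yE normrM powRM// ltr_pM2r//.
have [z0|z0] := leP 0 z; first by rewrite ger0_norm// bernoulli_strict.
by apply: (@lt_le_trans _ _ 0); rewrite ?powR_ge0//; nra.
Qed.

(** * Maximizers of coercive strictly concave functions *)

Lemma cV_box_compact (R : realType) (n : nat) (M : R) :
  compact [set v : 'cV[R]_n | forall i, `|v i 0| <= M].
Proof.
have rVc : compact [set v : 'rV[R]_n | forall i, `[- M, M]%classic (v ord0 i)].
  by apply: (@rV_compact R n (fun=> `[- M, M]%classic)) => _; exact: segment_compact.
have -> : [set v : 'cV[R]_n | forall i, `|v i 0| <= M] =
    trmx @` [set v : 'rV[R]_n | forall i, `[- M, M]%classic (v ord0 i)].
  apply/seteqP; split => [v vM|_ [v vM <-] i] /=.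
    exists v^T; last by rewrite trmxK.
    by move=> i /=; rewrite mxE in_itv/= -ler_norml; exact: vM.
  by move: (vM i); rewrite /= mxE in_itv/= -ler_norml.
apply: continuous_compact rVc; apply: continuous_subspaceT => v A /=.
move=> /nbhs_ballP[e e0 es]; apply/nbhs_ballP; exists e => //= w [_ vw].
by apply: es; split => // i j; rewrite !mxE.
Qed.

Lemma cV_continuousP (R : realType) (n : nat) (f : 'cV[R]_n -> R) (x : 'cV[R]_n)
    (e : R) : {for x, continuous f} -> 0 < e ->
  exists2 r : R, 0 < r & forall y : 'cV[R]_n, (forall i, `|x i 0 - y i 0| < r) -> `|f x - f y| < e.
Proof.
move=> fx e0; have /cvgrPdist_lt/(_ e e0)/nbhs_ballP[r r0 rf] := fx.
exists r => // y xy; apply: rf; split => // i j.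
by rewrite ord1 /ball/=; exact: xy.
Qed.

Definition coercive_above (R : realType) (n : nat) (f : 'cV[R]_n -> R) : Prop :=
  forall c, exists M, forall v, c <= f v -> forall i, `|v i 0| <= M.

Lemma coercive_attains_max (R : realType) (n : nat) (f : 'cV[R]_n -> R)
    (D : set 'cV[R]_n) : continuous f -> coercive_above f -> closed D ->
  D !=set0 -> exists2 u, D u & forall v, D v -> f v <= f u.
Proof.
move=> fc fcoer Dcl [x Dx]; have [M xM] := fcoer (f x).
pose K := D `&` [set v | f x <= f v].
have Kcl : closed K.
  apply: closedI => //.
  exact: (@preimage_closed _ _ f [set y | f x <= y] (fun v _ => fc v) (@closed_ge _ _)).
have Kco : compact K.
  by apply: (subclosed_compact Kcl (@cV_box_compact R n M)) => v [_ /xM].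
have Kx : K x by split => //=.
have [] := @compact_EVT_max _ _ f K _ Kco; first by exists x.
  exact: continuous_subspaceT.
move=> u; rewrite inE => -[Du xu] umax; exists u => // v Dv.
have [xv|/ltW vx] := leP (f x) (f v); first by apply: umax; rewrite inE.
exact: le_trans xu.
Qed.

(** The form in which strict concavity is available here: explicit tangent
    hyperplanes, strictly above the graph except at the point of contact. *)
Definition strict_supergradients (R : realType) (n : nat) (f : 'cV[R]_n -> R) :=
  forall m, exists L : 'I_n -> R, forall v, v != m ->
    f v < f m + \sum_i L i * (v i 0 - m i 0).

(** The tangent hyperplane at the midpoint of two distinct maximizers would exceed
    the maximum at both, hence on average; but this average is the value at the
    midpoint. *)
Lemma strict_supergradients_unique_max (R : realType) (n : nat)
    (f : 'cV[R]_n -> R) (u v : 'cV[R]_n) : strict_supergradients f ->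
  maximizer f u -> maximizer f v -> u = v.
Proof.
move=> fs umax vmax; apply/eqP; apply/negPn/negP => uv.
pose m := 2^-1 *: (u + v).
have um i : u i 0 - m i 0 = 2^-1 * (u i 0 - v i 0) by rewrite !mxE; field.
have vm i : v i 0 - m i 0 = - (2^-1 * (u i 0 - v i 0)) by rewrite !mxE; field.
have uNm : u != m.
  apply: contra uv => /eqP um'; apply/eqP/colP => i.
  by have := um i; rewrite -um' subrr => ?; lra.
have vNm : v != m.
  apply: contra uv => /eqP um'; apply/eqP/colP => i.
  by have := vm i; rewrite -um' subrr => ?; lra.
have [L fL] := fs m.
have := fL _ uNm; have := fL _ vNm.
under eq_bigr do rewrite vm mulrN; rewrite sumrN.
under [in X in _ -> X -> _]eq_bigr do rewrite um.
have := umax m; have := vmax m; have := umax v; lra.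
Qed.

Lemma rat_approx_cV (R : realType) (n : nat) (lo hi : 'I_n -> R) :
  (forall i, lo i < hi i) ->
  exists w : 'cV[rat]_n, forall i, lo i < (map_mx ratr w) i 0 < hi i.
Proof.
move=> lohi.
have /choice[w wP] : forall i, exists q : rat, lo i < ratr q < hi i.
  by move=> i; have [q] := rat_in_itvoo (lohi i); rewrite in_itv/=; exists q.
by exists (\col_i w i) => i; rewrite !mxE; exact: wP.
Qed.

(** The i-th coordinate of the maximizer is below c exactly when some rational
    point a with a_i < c is at least as good as all rational points b with
    c <= b_i: on the closed half-space the maximum is attained, and by uniqueness
    it is smaller than the global one.  So countably many comparisons decide the
    event. *)
Lemma measurable_argmax (R : realType) (dsp : measure_display)
    (T : measurableType dsp) (n : nat) (F : T -> 'cV[R]_n -> R)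
    (u : T -> 'cV[R]_n) :
  (forall v, measurable_fun [set: T] (F^~ v)) ->
  (forall t, continuous (F t)) -> (forall t, coercive_above (F t)) ->
  (forall t, unique (maximizer (F t)) (u t)) -> measurable_vector u.
Proof.
move=> mF cF coF umax i.
pose q (w : 'cV[rat]_n) : 'cV[R]_n := map_mx ratr w.
suff mlt (c : R) : measurable [set t | u t i 0 < c].
  apply: (measurability _ (measurable_realfun.RGenCInfty.measurableE R)).
  move=> _ [_ [c ->] <-].
  rewrite setTI (_ : _ @^-1` _ = ~` [set t | u t i 0 < c]); first exact: measurableC.
  apply/seteqP; split => t /=; rewrite in_itv/= andbT.
    by move=> ct; apply/negP; rewrite -leNgt.
  by move/negP; rewrite -leNgt.
have -> : [set t | u t i 0 < c] =
    \bigcup_(a : 'cV[rat]_n) \bigcap_(b : 'cV[rat]_n)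
      [set t | q a i 0 < c /\ (c <= q b i 0 -> F t (q b) <= F t (q a))].
  apply/seteqP; split => t /=.
  - move=> utc.
    (* s is the best point of the half-space; a is picked so close to the
       maximizer, and below it coordinatewise, that it beats s. *)
    have [utm utu] := umax t.
    have HD : closed [set v : 'cV[R]_n | c <= v i 0].
      by apply: (@preimage_closed _ _ (fun v : 'cV[R]_n => v i 0) [set y | c <= y]
        (fun v _ => @coord_continuous _ _ _ i 0 v)); exact: closed_ge.
    have [|s cs smax] := @coercive_attains_max _ _ _ _ (cF t) (coF t) HD.
      by exists (const_mx c); rewrite /= mxE.
    have sut : F t s < F t (u t).
      rewrite lt_neqAle utm andbT; apply/eqP => su.
      have : u t = s by apply: utu => v; rewrite su.
      by move=> E; move: cs; rewrite /= -E leNgt utc.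
    have [r r0 rF] := @cV_continuousP _ _ _ (u t) (F t (u t) - F t s) (cF t (u t))
       (ltac:(by rewrite subr_gt0)).
    have [a aP] := @rat_approx_cV R n (fun j => u t j 0 - r) (fun j => u t j 0)
      (ltac:(by move=> j; rewrite ltrBlDr ltrDl)).
    exists a => // b _ /=; split.
      by have /andP[_ /lt_trans] := aP i; apply.
    move=> /smax/le_trans; apply.
    have /rF : forall j, `|u t j 0 - q a j 0| < r.
      by move=> j; have /andP[? ?] := aP j; rewrite ger0_norm /q; lra.
    by rewrite ltr_norml; lra.
  - (* If the maximizer were in the half-space, rational points of the
       half-space approaching it from above would make a optimal too. *)
    move=> [a _ /= ab]; rewrite ltNge; apply/negP => cu.
    have [utm utu] := umax t.
    have ac : q a i 0 < c by have [] := ab 0 I.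
    have : u t = q a.
      apply: utu => v; apply: (le_trans (utm v)); apply/ler_addgt0Pr => e e0.
      have [r r0 rF] := @cV_continuousP _ _ _ (u t) e (cF t (u t)) e0.
      have [b bP] := @rat_approx_cV R n (fun j => u t j 0) (fun j => u t j 0 + r)
        (ltac:(by move=> j; rewrite ltrDl)).
      have /rF : forall j, `|u t j 0 - q b j 0| < r.
        by move=> j; have /andP[? ?] := bP j; rewrite ler0_norm /q; lra.
      have [_ /(_ _)] := ab b I; move=> /(_ (ltac:(by have /andP[/ltW ? _] := bP i; exact: le_trans cu _))).
      by rewrite ltr_norml; lra.
    by move=> E; move: cu; rewrite E leNgt ac.
apply: countable_bigcupT_measurable => [|a]; first exact: countableP.
rewrite -[X in measurable X]setCK setC_bigcap; apply/measurableC.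
apply: countable_bigcupT_measurable => [|b]; first exact: countableP.
apply: measurableC.
have [ac|ac] := ltP (q a i 0) c; last first.
  rewrite (_ : mkset _ = set0) //; apply/seteqP; by split => // t /= [].
have [bc|bc] := leP c (q b i 0); last first.
  rewrite (_ : mkset _ = setT) //; apply/seteqP; split => // t /= _; by split.
rewrite (_ : mkset _ = [set: T] `&` [set t | F t (q b) <= F t (q a)]).
  exact: measurable_fun_le.
by apply/seteqP; split => t /= [] // _ H; split => //; exact: H.
Qed.

(** * Densities and independence *)

(** The density agrees almost everywhere with the Radon-Nikodym derivative of nu,
    for which the change of variables is known. *)
Lemma integral_density (dsp : measure_display) (T : measurableType dsp)
    (R : realType) (mu : {sigma_finite_measure set T -> \bar R})
    (nu : probability T R) (g : T -> R) (f : T -> \bar R) :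
  measurable_fun [set: T] g -> (forall x, 0 <= g x) ->
  (forall B, measurable B -> nu B = (\int[mu]_(x in B) (g x)%:E)%E) ->
  measurable_fun [set: T] f -> (forall x, 0 <= f x)%E ->
  (\int[nu]_x f x = \int[mu]_x (f x * (g x)%:E))%E.
Proof.
move=> mg g0 nuE mf f0.
have mgE (A : set T) : measurable_fun A (EFin \o g).
  by apply: measurableT_comp => //; exact: measurable_funTS.
have numu : nu `<< mu.
  apply/null_content_dominatesP => B mB B0; rewrite nuE//.
  by apply: null_set_integral => //; exact: mgE.
rewrite -(Radon_Nikodym_SigmaFinite.change_of_variables numu f0 measurableT mf).
apply: ae_eq_integral => //.
- apply: emeasurable_funM => //.
  exact: measurable_int (Radon_Nikodym_SigmaFinite.f_integrable numu).
- by apply: emeasurable_funM => //; exact: mgE.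
apply: ae_eqe_mul2l; apply: integral_ae_eq => //.
- exact: Radon_Nikodym_SigmaFinite.f_integrable.
- by move=> E _ mE; rewrite -nuE//; apply/esym; exact: Radon_Nikodym_SigmaFinite.f_integral.
Qed.

Lemma integral_law (dsp : measure_display) (T : measurableType dsp)
    (R : realType) (P : probability T R) (X : {RV P >-> measurableTypeR R})
    (G : probability (measurableTypeR R) R) (f : R -> R) :
  (forall B, measurable B -> distribution P X B = G B) ->
  measurable_fun [set: R] f -> G.-integrable setT (EFin \o f) ->
  P.-integrable setT (fun t => (f (X t))%:E) /\
  \int[P]_t f (X t) = \int[G]_x f x.
Proof.
move=> XG mf /integrableP[mf' intf].
have mfX : measurable_fun [set: T] (fun t => (f (X t))%:E).
  by apply: measurableT_comp => //; apply: measurableT_comp.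
have intfX : P.-integrable setT (fun t => (f (X t))%:E).
  apply/integrableP; split => //.
  rewrite -(@ge0_integral_distribution _ _ _ _ _ P X (fun x => `|(f x)%:E|%E))//.
    rewrite (@eq_measure_integral _ _ _ _ G)// => B mB _; exact: XG.
  by apply: measurableT_comp => //; exact: measurableT_comp.
split => //; rewrite /Rintegral; congr fine.
rewrite -(@integral_distribution _ _ _ _ _ P X (EFin \o f))//.
by apply: eq_measure_integral => B mB _; exact: XG.
Qed.

(** Independence says that the law of (X, Y) agrees with the product of the laws
    on rectangles, hence everywhere; then Fubini's theorem applies. *)
Lemma integral_indep_mul (dsp : measure_display) (T : measurableType dsp)
    (R : realType) (P : probability T R) (X Y : {RV P >-> measurableTypeR R})
    (f g : R -> R) :
  (forall A B : set (measurableTypeR R), measurable A -> measurable B ->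
    P (X @^-1` A `&` Y @^-1` B) = (P (X @^-1` A) * P (Y @^-1` B))%E) ->
  measurable_fun [set: R] f -> measurable_fun [set: R] g ->
  P.-integrable setT (fun t => (f (X t))%:E) ->
  P.-integrable setT (fun t => (g (Y t))%:E) ->
  P.-integrable setT (fun t => (f (X t) * g (Y t))%:E) /\
  \int[P]_t (f (X t) * g (Y t)) = \int[P]_t f (X t) * \int[P]_t g (Y t).
Proof.
move=> XY mf mg intf intg.
pose Z t : measurableTypeR R * measurableTypeR R := (X t, Y t).
have mZ : measurable_fun [set: T] Z.
  by apply/measurable_fun_pairP; split; exact: measurable_funP.
pose ZZ := mfun_Sub (mem_set mZ : Z \in mfun).
pose mX := distribution P X; pose mY := distribution P Y.
have lawZ (C : set (measurableTypeR R * measurableTypeR R)) : measurable C ->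
    (mX \x mY)%E C = distribution P ZZ C.
  move=> mC; apply: (@product_measure_unique _ _ _ _ _ mX mY (distribution P ZZ) _ C mC).
  by move=> A B mA mB; exact: XY.
pose F (z : measurableTypeR R * measurableTypeR R) := (f z.1 * g z.2)%:E.
have mF : measurable_fun setT F.
  apply: measurableT_comp => //; apply: measurable_funM.
    exact: measurableT_comp.
  exact: measurableT_comp.
have mfE : measurable_fun [set: R] (EFin \o f) by exact: measurableT_comp.
have mgE : measurable_fun [set: R] (EFin \o g) by exact: measurableT_comp.
have intf' : mX.-integrable setT (EFin \o f) by exact: integrable_pushforward.
have intg' : mY.-integrable setT (EFin \o g) by exact: integrable_pushforward.
have intF : (mX \x mY)%E.-integrable setT F.
  apply/integrable12ltyP => //.
  under eq_integral => x _.
    rewrite /F /=.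
    under eq_integral => y _ do rewrite normrM EFinM.
    rewrite ge0_integralZl//; last by apply/measurable_EFinP; apply: measurableT_comp.
    over.
  rewrite /= ge0_integralZr//; last 2 first.
    by apply/measurable_EFinP; apply: measurableT_comp.
    exact: integral_ge0.
  have /integrableP[_ f1] := intf'; have /integrableP[_ g1] := intg'.
  by rewrite lte_mul_pinfty ?integral_ge0// ge0_fin_numE ?integral_ge0.
have mFZ : measurable_fun [set: T] (F \o Z) by exact: measurableT_comp.
have intFZ : P.-integrable setT (F \o Z).
  apply/integrableP; split => //.
  rewrite -(@ge0_integral_distribution _ _ _ _ _ P ZZ (abse \o F))//; last 2 first.
    by apply: measurableT_comp.
    by move=> y; exact: abse_ge0.
  rewrite (@eq_measure_integral _ _ _ _ (mX \x mY)%E); last by move=> B mB _; exact/esym/lawZ.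
  by have /integrableP[] := intF.
split => //.
rewrite /Rintegral -[LHS]/(fine (\int[P]_t (F \o Z) t)).
rewrite -(@integral_distribution _ _ _ _ _ P ZZ F)//.
rewrite (@eq_measure_integral _ _ _ _ (mX \x mY)%E); last by move=> B mB _; exact/esym/lawZ.
rewrite -integral12_prod_meas1//=.
rewrite (_ : (\int[P]_t (f (X t))%:E = \int[mX]_x (f x)%:E)%E); last first.
  by rewrite (@integral_distribution _ _ _ _ _ P X (EFin \o f)).
rewrite (_ : (\int[P]_t (g (Y t))%:E = \int[mY]_x (g x)%:E)%E); last first.
  by rewrite (@integral_distribution _ _ _ _ _ P Y (EFin \o g)).
rewrite -fineM; [|exact: integrable_fin_num..]; congr fine.
under eq_integral => x _.
  rewrite /fubini_F /F /=.
  under eq_integral => y _ do rewrite EFinM.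
  rewrite integralZl//.
  over.
rewrite /= -(fineK (integrable_fin_num measurableT intg')) integralZr//.
Qed.

(** * Chebyshev inequality for independent sums *)

Section Rintegral_facts.
Context (dsp : measure_display) (T : measurableType dsp) (R : realType)
  (P : probability T R).

Implicit Types f g : T -> R.

Lemma Rintegrable_cst c : P.-integrable setT (fun _ => c%:E).
Proof. exact: (finite_measure_integrable_cst P c measurableT). Qed.

Lemma Rintegrable_dominated f g : measurable_fun setT f ->
  (forall x, `|f x| <= g x) ->
  P.-integrable setT (fun x => (g x)%:E) -> P.-integrable setT (fun x => (f x)%:E).
Proof.
move=> mf fg; apply: (@le_integrable _ _ _ P) => //; first exact: measurableT_comp.
by move=> x _ /=; rewrite lee_fin (le_trans (fg x))// ler_norm.
Qed.

Lemma Rintegrable_of_sqr f : measurable_fun setT f ->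
  P.-integrable setT (fun x => (f x ^+ 2)%:E) -> P.-integrable setT (fun x => (f x)%:E).
Proof.
move=> mf f2; apply: (@Rintegrable_dominated _ (fun x => 1 + f x ^+ 2)) => //.
  move=> x; rewrite -[_ ^+ 2]real_normK ?num_real//.
  by have := sqr_ge0 (`|f x| - 1); have := normr_ge0 (f x); nra.
exact: (integrableD measurableT (Rintegrable_cst 1) f2).
Qed.

Lemma Rintegral_sum (I : finType) (F : I -> T -> R) :
  (forall i, P.-integrable setT (fun x => (F i x)%:E)) ->
  \int[P]_x (\sum_i F i x) = \sum_i \int[P]_x F i x.
Proof.
move=> iF; apply: EFin_inj; rewrite -sumEFin.
under [RHS]eq_bigr => i _ do rewrite fineK ?integrable_fin_num//.
rewrite fineK; last first.
  under eq_integral do rewrite -sumEFin.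
  by apply: integrable_fin_num => //; exact: integrable_sum.
by under eq_integral do rewrite -sumEFin; rewrite integral_sum.
Qed.

Lemma markov_sqr f (a s : R) : 0 < a -> measurable_fun setT f ->
  P.-integrable setT (fun x => (f x ^+ 2)%:E) -> \int[P]_x f x ^+ 2 <= s ->
  (P [set x | (a <= `|f x|)%R] <= (s / a ^+ 2)%:E)%E.
Proof.
move=> a0 mf if2 fs.
have a20 : 0 < a ^+ 2 by rewrite exprn_gt0.
have := @le_integral_comp_abse _ T R P setT measurableT (fun x => (f x ^+ 2)%:E)
   (a ^+ 2) id (@measurable_id _ _ setT) (fun r => id) _ _ a20.
move=> /(_ (fun x y _ _ xy => xy)) /(_ (measurable_int P if2)).
rewrite setTI.
have -> : [set x | ((a ^+ 2)%:E <= `|(f x ^+ 2)%:E|)%E] = [set x | a <= `|f x|].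
  by apply/funext => x; rewrite /= lee_fin normrX ler_sqr ?nnegrE// ltW.
have -> : (\int[P]_x `|(f x ^+ 2)%:E| = \int[P]_x (f x ^+ 2)%:E)%E.
  by apply: eq_integral => x _ /=; rewrite ger0_norm// sqr_ge0.
rewrite -(fineK (integrable_fin_num measurableT if2)) => H.
rewrite -(@lee_pmul2l _ (a ^+ 2)%:E)// ?lte_fin// -EFinM mulrC divfK ?gt_eqF//.
by apply: (le_trans H); rewrite lee_fin.
Qed.

End Rintegral_facts.

(** The terms may have different laws and non-zero means; centring them only
    decreases the second moments, and the cross terms vanish by independence. *)
Lemma chebyshev_indep_sum (dsp : measure_display) (T : measurableType dsp)
    (R : realType) (P : probability T R) (I : finType)
    (X : I -> {RV P >-> measurableTypeR R})
    (mu : I -> probability (measurableTypeR R) R) (f : I -> R -> R) (s : I -> R) (a : R) :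
  mutually_independent P (fun i => X i : T -> R) ->
  (forall i B, measurable B -> distribution P (X i) B = mu i B) ->
  (forall i, measurable_fun [set: R] (f i)) ->
  (forall i, (mu i).-integrable setT (fun x => (f i x ^+ 2)%:E)) ->
  (forall i, \int[mu i]_x (f i x ^+ 2) <= s i) -> 0 < a ->
  (P [set t | (a <= `|\sum_i (f i (X i t) - \int[mu i]_x f i x)|)%R]
     <= ((\sum_i s i) / a ^+ 2)%:E)%E.
Proof.
move=> indep law mf if2 fs a0.
pose g i x := f i x - \int[mu i]_x f i x.
have mg i : measurable_fun [set: R] (g i) by exact: measurable_funB.
have mfT i : measurable_fun [set: measurableTypeR R] (f i) by exact: mf.
have if1 i : (mu i).-integrable setT (fun x => (f i x)%:E).
  by apply: Rintegrable_of_sqr => //; exact: mf.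
have ig1 i : (mu i).-integrable setT (fun x => (g i x)%:E).
  exact: (integrableB measurableT (if1 i) (Rintegrable_cst (mu i) _)).
have cst_int i (c : R) : \int[mu i]_x c = c.
  rewrite Rintegral_cst// -[RHS]mulr1; congr (_ * _).
  exact: (congr1 fine (probability_setT (mu i))).
have g1 i : \int[mu i]_x g i x = 0.
  have ic := Rintegrable_cst (mu i) (\int[mu i]_x f i x).
  by rewrite (RintegralB measurableT (if1 i) ic) cst_int subrr.
have g2E i : (fun x => g i x ^+ 2) = (fun x => f i x ^+ 2
    - (2 * \int[mu i]_x f i x) * f i x + (\int[mu i]_x f i x) ^+ 2).
  by apply/funext => x; rewrite /g; ring.
have im i : (mu i).-integrable setT (fun x => ((2 * \int[mu i]_x f i x) * f i x)%:E).
  exact: (integrableZl measurableT _ (if1 i)).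
have ifm i : (mu i).-integrable setT (fun x => (f i x ^+ 2 - (2 * \int[mu i]_x f i x) * f i x)%:E).
  exact: (integrableB measurableT (if2 i) (im i)).
have ig2 i : (mu i).-integrable setT (fun x => (g i x ^+ 2)%:E).
  have -> : (fun x => (g i x ^+ 2)%:E) = EFin \o (fun x => g i x ^+ 2) by [].
  rewrite g2E; exact: (integrableD measurableT (ifm i) (Rintegrable_cst (mu i) _)).
have g2 i : \int[mu i]_x (g i x ^+ 2) <= s i.
  apply: le_trans (fs i).
  have -> : \int[mu i]_x (g i x ^+ 2) = \int[mu i]_x (f i x ^+ 2) - (\int[mu i]_x f i x) ^+ 2.
    rewrite -[LHS]/(Rintegral (mu i) setT (fun x => g i x ^+ 2)) g2E.
    rewrite (RintegralD measurableT (ifm i) (Rintegrable_cst (mu i) _)).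
    rewrite (RintegralB measurableT (if2 i) (im i)) (RintegralZl _ measurableT (if1 i)) cst_int; ring.
  by rewrite gerBl sqr_ge0.
have pairE i j : i != j -> forall A B : set (measurableTypeR R), measurable A -> measurable B ->
    P (X i @^-1` A `&` X j @^-1` B) = (P (X i @^-1` A) * P (X j @^-1` B))%E.
  move=> ij A B mA mB.
  pose C k : set (measurableTypeR R) := if k == i then A else if k == j then B else setT.
  have mC k : measurable (C k) by rewrite /C; case: ifP => // _; case: ifP.
  have := indep C mC.
  rewrite (bigD1 i)//= (bigD1 j) 1?eq_sym//= big1; last first.
    move=> k /andP[ki kj]; rewrite /C (negbTE ki) (negbTE kj).
    by rewrite preimage_setT probability_setT.
  rewrite mule1 /C !eqxx [j == i]eq_sym (negbTE ij) => <-.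
  congr (P _); apply/seteqP; split => t /=.
    move=> [Ai Bj] k _ /=; case: eqP => [->//|_]; case: eqP => [->//|//].
  by move=> H; split; [have := H i Logic.I; rewrite /= eqxx|
    have := H j Logic.I; rewrite /= eqxx eq_sym (negbTE ij)].
pose Y i t := g i (X i t).
have iY i : P.-integrable setT (fun t => (Y i t)%:E) /\ \int[P]_t Y i t = 0.
  by have [? E] := integral_law (law i) (mg i) (ig1 i); split => //; rewrite -(g1 i) -E.
have YY i j : P.-integrable setT (fun t => (Y i t * Y j t)%:E) /\
    \int[P]_t (Y i t * Y j t) <= if i == j then s i else 0.
  have [<-|ij] := eqVneq i j.
    have [? E] := @integral_law _ _ _ P _ _ (fun x => g i x ^+ 2) (law i) (measurable_funX 2 (mg i)) (ig2 i).
    by split => //; rewrite -[X in X <= _]/(\int[P]_t (g i (X i t) ^+ 2)) E.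
  have [? ->] := integral_indep_mul (pairE _ _ ij) (mg i) (mg j) (iY i).1 (iY j).1.
  by split => //; rewrite (iY i).2 mul0r.
have sqE t : (\sum_i Y i t) ^+ 2 = \sum_i \sum_j Y i t * Y j t.
  by rewrite expr2 big_distrl/=; apply: eq_bigr => i _; rewrite big_distrr.
have iYY i : P.-integrable setT (fun t => (\sum_j Y i t * Y j t)%:E).
  under eq_fun do rewrite -sumEFin.
  by apply: integrable_sum => // j _; exact: (YY i j).1.
apply: (@markov_sqr _ _ _ P (fun t => \sum_i Y i t)) => //.
- have mY i : measurable_fun [set: T] (Y i).
    apply: (@measurableT_comp _ _ _ _ (measurableTypeR R) _ (g i) setT (X i)); first exact: mg.
    exact: measurable_funP.
  exact: measurable_sum.
- under eq_fun do rewrite sqE -sumEFin.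
  by apply: integrable_sum.
- under eq_Rintegral do rewrite sqE.
  rewrite Rintegral_sum//; apply: ler_sum => i _.
  rewrite Rintegral_sum; last by move=> j; exact: (YY i j).1.
  apply: (@le_trans _ _ (\sum_j if i == j then s i else 0)).
    by apply: ler_sum => j _; exact: (YY i j).2.
  by rewrite -big_mkcond/= (big_pred1 i)// => j; rewrite /= eq_sym.
Qed.

(** * The linear predictor and exponential tilting *)

(** The covariate vector z = (1, h(x)')', for which the linear predictor is the
    inner product of theta and z. *)
Definition feature (R : realType) (d : nat) (h : R -> 'cV[R]_d) (x : R) :
  'cV[R]_(1 + d) := col_mx (const_mx 1) (h x).

Lemma linpredE (R : realType) (d : nat) (h : R -> 'cV[R]_d)
    (theta : 'cV[R]_(1 + d)) (x : R) :
  linpred h theta x = \sum_i theta i 0 * feature h x i 0.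
Proof.
rewrite big_split_ord/= big_ord1 /linpred /feature col_mxEu [const_mx _ _ _]mxE mulr1.
congr (_ + _); first by rewrite /intercept mxE.
by rewrite mxE; apply: eq_bigr => j _; rewrite col_mxEd /slope !mxE.
Qed.

Lemma linpredB (R : realType) (d : nat) (h : R -> 'cV[R]_d)
    (theta m : 'cV[R]_(1 + d)) (x : R) :
  linpred h theta x - linpred h m x = \sum_i (theta i 0 - m i 0) * feature h x i 0.
Proof. by rewrite !linpredE -sumrB; apply: eq_bigr => i _; rewrite mulrBl. Qed.

Lemma measurable_feature (R : realType) (d : nat) (h : R -> 'cV[R]_d) :
  (forall i : 'I_d, measurable_fun [set: R] (fun x => h x i 0)) ->
  forall i, measurable_fun [set: R] (fun x => feature h x i 0).
Proof.
move=> mh i; rewrite /feature; case: (split_ordP i) => j ->.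
  under eq_fun do rewrite col_mxEu mxE; exact: measurable_cst.
under eq_fun do rewrite col_mxEd; exact: mh.
Qed.

Lemma measurable_linpred (R : realType) (d : nat) (h : R -> 'cV[R]_d)
    (theta : 'cV[R]_(1 + d)) :
  (forall i : 'I_d, measurable_fun [set: R] (fun x => h x i 0)) ->
  measurable_fun [set: R] (linpred h theta).
Proof.
move=> mh; rewrite (_ : linpred h theta = fun x => \sum_i theta i 0 * feature h x i 0).
  by apply: measurable_sum => i; apply: measurable_funM => //; exact: measurable_feature.
by apply/funext => x; exact: linpredE.
Qed.

Lemma matAE (R : realType) (d : nat) (h : R -> 'cV[R]_d)
    (theta0 : 'cV[R]_(1 + d)) (rho1 : R)
    (G2 : probability (measurableTypeR R) R) (i j : 'I_(1 + d)) :
  matA h theta0 rho1 G2 i j =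
  \int[G2]_x (weight h theta0 rho1 x * (feature h x i 0 * feature h x j 0)).
Proof.
have hh x (a b : 'I_d) : (h x *m (h x)^T) a b = h x a 0 * h x b 0.
  by rewrite mxE big_ord1 !mxE.
rewrite /matA /feature.
case: (split_ordP i) => a ->; case: (split_ordP j) => b ->.
- rewrite block_mxEul /A11 !mxE !ord1 eqxx mulr1n; apply: eq_Rintegral => x _.
  by rewrite col_mxEu mxE !mulr1.
- rewrite block_mxEur /A21 !mxE; apply: eq_Rintegral => x _.
  by rewrite col_mxEu col_mxEd mxE mul1r.
- rewrite block_mxEdl /A21 !mxE; apply: eq_Rintegral => x _.
  by rewrite col_mxEu col_mxEd mxE mulr1.
- rewrite block_mxEdr /A22 !mxE; apply: eq_Rintegral => x _.
  by rewrite !col_mxEd hh.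
Qed.

Lemma weighted_features_integrable (R : realType) (d : nat) (h : R -> 'cV[R]_d)
    (theta0 : 'cV[R]_(1 + d)) (rho1 : R)
    (G2 : probability (measurableTypeR R) R) (i j : 'I_(1 + d)) :
  finite_A_integrals h theta0 rho1 G2 ->
  G2.-integrable setT
    (fun x => (weight h theta0 rho1 x * (feature h x i 0 * feature h x j 0))%:E).
Proof.
have hh x (a b : 'I_d) : (h x *m (h x)^T) a b = h x a 0 * h x b 0.
  by rewrite mxE big_ord1 !mxE.
move=> [i11 i21 i22]; rewrite /feature.
case: (split_ordP i) => a ->; case: (split_ordP j) => b ->.
- under [X in integrable _ _ X]eq_fun do rewrite !col_mxEu !mxE !mulr1; exact: i11.
- under [X in integrable _ _ X]eq_fun do rewrite col_mxEu col_mxEd mxE mul1r; exact: i21.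
- under [X in integrable _ _ X]eq_fun do rewrite col_mxEu col_mxEd mxE mulr1; exact: i21.
- under [X in integrable _ _ X]eq_fun do rewrite !col_mxEd -hh; exact: i22.
Qed.

Lemma integral_tilt_ge0 (R : realType) (r g1 g2 : R -> R)
    (G1 G2 : probability (measurableTypeR R) R) (f : R -> R) :
  is_density g1 G1 -> is_density g2 G2 -> (forall x, g1 x = r x * g2 x) ->
  measurable_fun [set: R] r -> (forall x, 0 <= r x) ->
  measurable_fun [set: R] f -> (forall x, 0 <= f x) ->
  (\int[G1]_x (f x)%:E = \int[G2]_x (f x * r x)%:E)%E.
Proof.
move=> [mg1 g10 G1E] [mg2 g20 G2E] g12 mr r0 mf f0.
have mfE : measurable_fun [set: R] (EFin \o f) by exact: measurableT_comp.
have mfrE : measurable_fun [set: R] (fun x => (f x * r x)%:E).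
  by apply/measurable_EFinP; exact: measurable_funM.
rewrite (integral_density (mu := lebesgue_measure) mg1 g10 G1E mfE); last first.
  by move=> x; rewrite lee_fin.
rewrite (integral_density (mu := lebesgue_measure) mg2 g20 G2E mfrE); last first.
  by move=> x; rewrite lee_fin mulr_ge0.
by apply: eq_integral => x _; rewrite g12 -!EFinM mulrA.
Qed.

(** Reduction to non-negative functions through positive and negative parts. *)
Lemma integral_tilt (R : realType) (r g1 g2 : R -> R)
    (G1 G2 : probability (measurableTypeR R) R) (f : R -> R) :
  is_density g1 G1 -> is_density g2 G2 -> (forall x, g1 x = r x * g2 x) ->
  measurable_fun [set: R] r -> (forall x, 0 <= r x) -> measurable_fun [set: R] f ->
  G2.-integrable setT (fun x => (f x * r x)%:E) ->
  G1.-integrable setT (fun x => (f x)%:E) /\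
  \int[G1]_x f x = \int[G2]_x (f x * r x).
Proof.
move=> d1 d2 g12 mr r0 mf ifr.
have tilt := integral_tilt_ge0 d1 d2 g12 mr r0.
have mfT : measurable_fun [set: measurableTypeR R] f by exact: mf.
have mrT : measurable_fun [set: measurableTypeR R] r by exact: mr.
have if1 : G1.-integrable setT (fun x => (f x)%:E).
  apply/integrableP; split; first exact: measurableT_comp.
  under eq_integral do rewrite abse_EFin.
  rewrite tilt//; last exact: measurableT_comp.
  have /integrableP[_] := ifr; apply: le_lt_trans; rewrite le_eqVlt; apply/orP; left; apply/eqP.
  by apply: eq_integral => x _ /=; rewrite normrM (ger0_norm (r0 x)).
split => //.
pose fp x := Num.max (f x) 0; pose fn x := Num.max (- f x) 0.
have fpn : f = (fun x => fp x - fn x).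
  by apply/funext => x; rewrite /fp /fn; case: (leP (f x) 0); case: (leP (- f x) 0) => ? ?; lra.
have mfp : measurable_fun [set: R] fp by exact: measurable_maxr.
have mfn : measurable_fun [set: R] fn by apply: measurable_maxr => //; exact: measurableT_comp.
have fp0 x : 0 <= fp x by rewrite le_max lexx orbT.
have fn0 x : 0 <= fn x by rewrite le_max lexx orbT.
have fpf x : fp x <= `|f x| by rewrite ge_max ler_norm normr_ge0.
have fnf x : fn x <= `|f x| by rewrite ge_max -[X in _ <= X]normrN ler_norm normr_ge0.
have int1 (u : R -> R) : measurable_fun [set: R] u -> (forall x, 0 <= u x) -> (forall x, u x <= `|f x|) ->
    G1.-integrable setT (fun x => (u x)%:E) /\ G2.-integrable setT (fun x => (u x * r x)%:E).
  move=> mu u0 uf; split.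
    apply: (@Rintegrable_dominated _ (measurableTypeR R) R G1 u (fun x => `|f x|)) => //.
      by move=> x; rewrite ger0_norm.
    exact: (integrable_norm if1).
  apply: (@Rintegrable_dominated _ (measurableTypeR R) R G2 (fun x => u x * r x) (fun x => `|f x * r x|)) => //.
  - by apply: measurable_funM => //; exact: mu.
  - by move=> x; rewrite !normrM ler_wpM2r// ger0_norm.
  - exact: (integrable_norm ifr).
have [p1 p2] := int1 _ mfp fp0 fpf; have [n1 n2] := int1 _ mfn fn0 fnf.
have -> : \int[G1]_x f x = \int[G1]_x fp x - \int[G1]_x fn x.
  by rewrite -RintegralB//; rewrite {1}fpn.
have -> : \int[G2]_x (f x * r x) = \int[G2]_x (fp x * r x) - \int[G2]_x (fn x * r x).
  rewrite -RintegralB//; apply: eq_Rintegral => x _.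
  by rewrite -mulrBl; congr (_ * _); rewrite {1}fpn.
by congr (_ - _); rewrite /Rintegral tilt.
Qed.

(** * Concavity of the penalized log-likelihood *)

Definition sigmoid (R : realType) (rho eta : R) : R :=
  rho * expR eta / (1 + rho * expR eta).

Lemma sigmoid_itv (R : realType) (rho eta : R) : 0 < rho -> 0 < sigmoid rho eta < 1.
Proof.
move=> rho0; have e0 : 0 < rho * expR eta by rewrite mulr_gt0 ?expR_gt0.
by rewrite /sigmoid divr_gt0 ?addr_gt0//= ltr_pdivrMr ?addr_gt0// mul1r ltrDr.
Qed.

(** A lower bound for the amount by which t |-> ln (1 + rho e^t) exceeds at
    eta + delta its tangent at eta ([softplus_gap]). *)
Definition curvature (R : realType) (rho eta delta : R) : R :=
  sigmoid rho eta * (1 - sigmoid rho eta) * (delta ^+ 2 / (2 * (1 + `|delta|))).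

Lemma curvature_ge0 (R : realType) (rho eta delta : R) : 0 < rho ->
  0 <= curvature rho eta delta.
Proof.
move=> /(sigmoid_itv eta)/andP[p0 p1]; rewrite mulr_ge0//.
  by rewrite mulr_ge0 ?subr_ge0 ?ltW.
by rewrite divr_ge0 ?sqr_ge0// mulr_ge0// addr_ge0.
Qed.

Lemma curvature_gt0 (R : realType) (rho eta delta : R) : 0 < rho -> delta != 0 ->
  0 < curvature rho eta delta.
Proof.
move=> /(sigmoid_itv eta)/andP[p0 p1] d0; rewrite mulr_gt0//.
  by rewrite mulr_gt0 ?subr_gt0.
by rewrite divr_gt0 ?exprn_even_gt0// mulr_gt0// ltr_pwDl.
Qed.

(** Dividing 1 + rho e^eta' by 1 + rho e^eta gives 1 - p + p e^(eta' - eta), where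
    p is the sigmoid at eta. *)
Lemma softplus_gap (R : realType) (rho eta eta' : R) : 0 < rho ->
  ln (1 + rho * expR eta) + sigmoid rho eta * (eta' - eta)
    + curvature rho eta (eta' - eta) <= ln (1 + rho * expR eta').
Proof.
move=> rho0; have e0 : 0 < rho * expR eta by rewrite mulr_gt0 ?expR_gt0.
have D0 : 0 < 1 + rho * expR eta by rewrite addr_gt0.
have /andP[p0 p1] := sigmoid_itv eta rho0.
have := log_mgf_gap (eta' - eta) (sigmoid_itv eta rho0).
rewrite -/(curvature _ _ _) lerBrDr.
have -> : 1 + rho * expR eta' = (1 + rho * expR eta) *
    (1 - sigmoid rho eta + sigmoid rho eta * expR (eta' - eta)).
  have -> : rho * expR eta' = rho * expR eta * expR (eta' - eta).
    by rewrite -mulrA -expRD addrC subrK.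
  by rewrite /sigmoid; field; rewrite gt_eqF.
rewrite lnM ?posrE//; first by lra.
by rewrite addr_gt0 ?subr_gt0// mulr_gt0 ?expR_gt0.
Qed.

(** The binary response of the logistic regression on the pooled sample. *)
Definition from_first (m n : nat) (k : 'I_m + 'I_n) : bool :=
  if k is inl _ then true else false.

Lemma loglikE (R : realType) (d : nat) (h : R -> 'cV[R]_d) (m n : nat)
    (x1 : 'I_m -> R) (x2 : 'I_n -> R) (theta : 'cV[R]_(1 + d)) :
  loglik h x1 x2 theta = \sum_k ((from_first k)%:R * linpred h theta (pooled x1 x2 k)
    - ln (1 + m%:R / n%:R * expR (linpred h theta (pooled x1 x2 k)))).
Proof.
rewrite big_sumType/= /loglik !sumrB.
under [in RHS]eq_bigr do rewrite mul1r.
under [X in _ = _ + (X - _)]eq_bigr do rewrite mul0r.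
by rewrite big1_eq; ring.
Qed.

(** The gradient of the log-likelihood at theta. *)
Definition score (R : realType) (d : nat) (h : R -> 'cV[R]_d) (m n : nat)
    (x1 : 'I_m -> R) (x2 : 'I_n -> R) (theta : 'cV[R]_(1 + d)) (i : 'I_(1 + d)) : R :=
  \sum_k ((from_first k)%:R - sigmoid (m%:R / n%:R) (linpred h theta (pooled x1 x2 k)))
    * feature h (pooled x1 x2 k) i 0.

Lemma loglik_gap (R : realType) (d : nat) (h : R -> 'cV[R]_d) (m n : nat)
    (x1 : 'I_m -> R) (x2 : 'I_n -> R) (theta theta0 : 'cV[R]_(1 + d)) :
  (0 < m)%N -> (0 < n)%N ->
  loglik h x1 x2 theta <= loglik h x1 x2 theta0
    + \sum_i score h x1 x2 theta0 i * (theta i 0 - theta0 i 0)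
    - \sum_k curvature (m%:R / n%:R) (linpred h theta0 (pooled x1 x2 k))
       (\sum_i (theta i 0 - theta0 i 0) * feature h (pooled x1 x2 k) i 0).
Proof.
move=> m0 n0; have rho0 : 0 < m%:R / n%:R :> R by rewrite divr_gt0 ?ltr0n.
rewrite !loglikE.
have -> : \sum_i score h x1 x2 theta0 i * (theta i 0 - theta0 i 0) =
   \sum_k ((from_first k)%:R - sigmoid (m%:R / n%:R) (linpred h theta0 (pooled x1 x2 k)))
    * (linpred h theta (pooled x1 x2 k) - linpred h theta0 (pooled x1 x2 k)).
  rewrite /score; under eq_bigr do rewrite big_distrl/=.
  rewrite exchange_big; apply: eq_bigr => k _; rewrite linpredB big_distrr/=.
  by apply: eq_bigr => i _; ring.
rewrite -big_split -sumrB/=; apply: ler_sum => k _.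
have := softplus_gap (linpred h theta0 (pooled x1 x2 k)) (linpred h theta (pooled x1 x2 k)) rho0.
rewrite -linpredB; lra.
Qed.

Lemma bridge_penalty_tangent (R : realType) (d : nat) (q : R) (b0 : 'cV[R]_d) :
  1 < q -> exists s : 'I_d -> R, forall b : 'cV[R]_d,
    bridge_penalty q b0 + \sum_j s j * (b j 0 - b0 j 0) <= bridge_penalty q b ?= iff (b == b0).
Proof.
move=> q1.
have /choice[s sP] : forall j, exists s, forall y, y != b0 j 0 ->
    `|b0 j 0| `^ q + s * (y - b0 j 0) < `|y| `^ q.
  by move=> j; exact: powR_norm_tangent.
exists s => b.
have H j : `|b0 j 0| `^ q + s j * (b j 0 - b0 j 0) <= `|b j 0| `^ q ?= iff (b j 0 == b0 j 0).
  have [->|bj] := eqVneq (b j 0) (b0 j 0).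
    by rewrite subrr mulr0 addr0; exact/leif_refl.
  by apply/leifP; exact: sP.
rewrite /bridge_penalty -big_split/=.
have := leif_sum (fun j (_ : xpredT j) => H j).
suff -> : [forall (j | xpredT j), b j 0 == b0 j 0] = (b == b0) by [].
apply/idP/eqP => [/forallP E|->]; last by apply/forallP => j; rewrite eqxx.
by apply/colP => j; apply/eqP; exact: (E j).
Qed.

(** If the slopes differ, the penalty makes the inequality strict.  If only the
    intercepts differ, every linear predictor moves by the same non-zero amount,
    so that any single observation does. *)
Lemma penalized_loglik_supergradients (R : realType) (d : nat) (h : R -> 'cV[R]_d)
    (q lam : R) (m n : nat) (x1 : 'I_m -> R) (x2 : 'I_n -> R) :
  (0 < m)%N -> (0 < n)%N -> 1 < q -> 0 < lam ->
  strict_supergradients (penalized_loglik h q lam x1 x2).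
Proof.
move=> m0 n0 q1 lam0 v0; have rho0 : 0 < m%:R / n%:R :> R by rewrite divr_gt0 ?ltr0n.
have [s sP] := bridge_penalty_tangent (slope v0) q1.
exists (fun i => score h x1 x2 v0 i -
   match fintype.split i with inl _ => 0 | inr j => lam * s j end) => v vv0.
have gap := loglik_gap h x1 x2 v v0 m0 n0.
have pen := sP (slope v).
have -> : \sum_i (score h x1 x2 v0 i - match fintype.split i with inl _ => 0 | inr j => lam * s j end)
     * (v i 0 - v0 i 0) = \sum_i score h x1 x2 v0 i * (v i 0 - v0 i 0)
   - lam * \sum_j s j * (slope v j 0 - slope v0 j 0).
  under eq_bigr do rewrite mulrBl.
  rewrite sumrB; congr (_ - _).
  rewrite big_split_ord/= big1 ?add0r; last first.
    move=> i _; case: split_ordP => j; first by rewrite mul0r.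
    by move=> /eqP; rewrite eq_lrshift.
  rewrite big_distrr/=; apply: eq_bigr => i _; case: split_ordP => j.
    by move=> /eqP; rewrite eq_rlshift.
  by move=> /rshift_inj ->; rewrite /slope !mxE mulrA.
set cur := \sum_k curvature _ _ _ in gap.
have cur0 : 0 <= cur by apply: sumr_ge0 => k _; exact: curvature_ge0.
rewrite /penalized_loglik.
have [slope_eq|slope_neq] := eqVneq (slope v) (slope v0); last first.
  have : bridge_penalty q (slope v0) + \sum_j s j * (slope v j 0 - slope v0 j 0)
     < bridge_penalty q (slope v) by rewrite (lt_leif pen).
  by rewrite -(ltr_pM2l lam0); lra.
suff cur_gt0 : 0 < cur.
  by move: pen.1; rewrite -(ler_pM2l lam0); lra.
pose k0 : 'I_m + 'I_n := inl (Ordinal m0).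
rewrite /cur (bigD1 k0)//= ltr_pwDl//; last first.
  by apply: sumr_ge0 => k _; exact: curvature_ge0.
apply: curvature_gt0 => //.
rewrite big_split_ord/= big_ord1 [X in _ + X]big1 ?addr0; last first.
  move=> j _; have := congr1 (fun w : 'cV[R]_d => w j 0) slope_eq.
  by rewrite /slope !mxE => ->; rewrite subrr mul0r.
rewrite /feature col_mxEu mxE mulr1 subr_eq0; apply: contra vv0 => /eqP E.
apply/eqP/colP => i; case: (split_ordP i) => j ->; first by rewrite ord1.
by have := congr1 (fun w : 'cV[R]_d => w j 0) slope_eq; rewrite /slope !mxE.
Qed.

Lemma continuous_powR_norm (R : realType) (q : R) : 0 < q ->
  continuous (fun y : R => `|y| `^ q).
Proof.
move=> q0 x; have [->|x0] := eqVneq x 0; last first.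
  apply: (@continuous_comp _ _ _ (fun y : R => `|y|) (fun a => a `^ q)).
    exact: norm_continuous.
  apply: differentiable_continuous; apply/derivable1_diffP; apply: derivable_powR.
  by rewrite in_itv/= andbT normr_gt0.
apply/cvgrPdist_lt => e e0; apply/nbhs_ballP.
exists (e `^ q^-1); first by rewrite /= powR_gt0.
move=> y; rewrite /ball/= sub0r normrN => ye.
rewrite normr0 powR0 ?gt_eqF// sub0r normrN ger0_norm ?powR_ge0//.
suff : `|y| `^ q < (e `^ q^-1) `^ q by rewrite -powRrM mulVf ?gt_eqF// powRr1// ltW.
by apply: gt0_ltr_powR => //; rewrite ?nnegrE ?powR_ge0.
Qed.

Lemma continuous_sumr (R : realType) (U : topologicalType) (I : finType)
    (F : I -> U -> R) :
  (forall i, continuous (F i)) -> continuous (fun x => \sum_i F i x).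
Proof.
move=> cF; apply: continuous_big => //; exact: add_continuous.
Qed.

Lemma continuous_linpred (R : realType) (d : nat) (h : R -> 'cV[R]_d) (x : R) :
  continuous (fun theta => linpred h theta x).
Proof.
have -> : (fun theta => linpred h theta x) = fun theta => \sum_i theta i 0 * feature h x i 0.
  by apply/funext => theta; exact: linpredE.
apply: continuous_sumr => i theta.
by apply: continuousM; [exact: coord_continuous|exact: cst_continuous].
Qed.

Lemma continuous_penalized_loglik (R : realType) (d : nat) (h : R -> 'cV[R]_d)
    (q lam : R) (m n : nat) (x1 : 'I_m -> R) (x2 : 'I_n -> R) :
  1 < q -> continuous (penalized_loglik h q lam x1 x2).
Proof.
move=> q1 theta.
have rho0 : 0 <= m%:R / n%:R :> R by rewrite divr_ge0.
apply: continuousB.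
  rewrite (_ : loglik h x1 x2 = fun theta => \sum_k
     ((from_first k)%:R * linpred h theta (pooled x1 x2 k)
      - ln (1 + m%:R / n%:R * expR (linpred h theta (pooled x1 x2 k))))); last first.
    by apply/funext => ?; exact: loglikE.
  apply: continuous_sumr => k {}theta; set x := pooled x1 x2 k.
  have clin : {for theta, continuous (fun v => linpred h v x)} by exact: continuous_linpred.
  apply: (@continuousB _ _ _ (fun v => (from_first k)%:R * linpred h v x)
    (fun v => ln (1 + m%:R / n%:R * expR (linpred h v x)))).
    by apply: continuousM => //; exact: cst_continuous.
  apply: (@continuous_comp _ _ _ (fun v => 1 + m%:R / n%:R * expR (linpred h v x)) (@ln R)).
    apply: continuousD; first exact: cst_continuous.
    apply: continuousM; first exact: cst_continuous.
    by apply: continuous_comp => //; exact: continuous_expR.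
  by apply: continuous_ln; rewrite ltr_pwDl// mulr_ge0 ?expR_ge0.
apply: continuousM; first exact: cst_continuous.
apply: continuous_sumr => j {}theta.
apply: (@continuous_comp _ _ _ (fun v : 'cV[R]_(1 + d) => slope v j 0) (fun y => `|y| `^ q)).
  rewrite (_ : (fun v => _) = fun v : 'cV[R]_(1 + d) => v (rshift 1 j) 0).
    exact: coord_continuous.
  by apply/funext => v; rewrite /slope mxE.
by apply: continuous_powR_norm; lra.
Qed.

(** * Coercivity and existence of the maximizer *)

Lemma sum_le_one_term (R : realType) (I : finType) (F : I -> R) (K : R) (i : I) :
  0 <= K -> (forall j, F j <= K) -> \sum_j F j <= F i + #|I|%:R * K.
Proof.
move=> K0 FK; rewrite (bigD1 i)//= lerD2l.
apply: (@le_trans _ _ (\sum_(j in I | j != i) K)); first exact: ler_sum.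
apply: (@le_trans _ _ (\sum_(j : I) K)); last by rewrite sumr_const mulr_natl.
by rewrite [leRHS](bigD1 i)//= lerDr.
Qed.

(** The penalty bounds the slope.  Given that, an observation of the first sample
    prevents the intercept from tending to - oo, and one of the second sample
    prevents it from tending to + oo: their terms are at most eta and
    - ln rho - eta respectively, while every term is at most |ln rho|. *)
Lemma coercive_penalized_loglik (R : realType) (d : nat) (h : R -> 'cV[R]_d)
    (q lam : R) (m n : nat) (x1 : 'I_m -> R) (x2 : 'I_n -> R) :
  (0 < m)%N -> (0 < n)%N -> 1 < q -> 0 < lam ->
  coercive_above (penalized_loglik h q lam x1 x2).
Proof.
move=> m0 n0 q1 lam0 c.
set rho := m%:R / n%:R : R.
have rho0 : 0 < rho by rewrite divr_gt0 ?ltr0n.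
pose K := `|ln rho|.
pose S := #|{: 'I_m + 'I_n}|%:R * K - c.
pose B := 1 + S / lam.
pose H := \sum_j (`|h (x1 (Ordinal m0)) j 0| + `|h (x2 (Ordinal n0)) j 0|).
exists (Num.max B (S + K + B * H)) => v cv i.
pose F k := (from_first k)%:R * linpred h v (pooled x1 x2 k)
    - ln (1 + rho * expR (linpred h v (pooled x1 x2 k))).
have ln_ge0' x : 0 <= ln (1 + rho * expR x).
  by rewrite ln_ge0// lerDl mulr_ge0 ?expR_ge0 ?ltW.
have ln_ge x : ln rho + x <= ln (1 + rho * expR x).
  have e0 : 0 < rho * expR x by rewrite mulr_gt0 ?expR_gt0.
  rewrite -{1}[x]expRK -lnM ?posrE ?expR_gt0// ler_ln ?posrE ?addr_gt0//.
  by rewrite lerDr.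
have lnrhoK : - K <= ln rho by rewrite lerNl /K -normrN ler_norm.
have K0 : 0 <= K by exact: normr_ge0.
have FK k : F k <= K.
  rewrite /F; case: k => j /=.
    by rewrite mul1r; have := ln_ge (linpred h v (x1 j)); lra.
  by rewrite mul0r sub0r; have := ln_ge0' (linpred h v (x2 j)); lra.
have pen0 : 0 <= bridge_penalty q (slope v) by apply: sumr_ge0 => j _; exact: powR_ge0.
have cF : c <= \sum_k F k - lam * bridge_penalty q (slope v).
  by move: cv; rewrite /penalized_loglik loglikE.
have lpen : 0 <= lam * bridge_penalty q (slope v) by rewrite mulr_ge0// ltW.
have low : - S <= linpred h v (x1 (Ordinal m0)).
  have := sum_le_one_term (inl (Ordinal m0) : 'I_m + 'I_n) K0 FK.
  rewrite {2}/F /= mul1r; have := ln_ge0' (linpred h v (x1 (Ordinal m0))).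
  by rewrite /S; lra.
have up : linpred h v (x2 (Ordinal n0)) <= S + K.
  have := sum_le_one_term (inr (Ordinal n0) : 'I_m + 'I_n) K0 FK.
  rewrite {2}/F /= mul0r; have := ln_ge (linpred h v (x2 (Ordinal n0))).
  by rewrite /S; lra.
have penS : lam * bridge_penalty q (slope v) <= S.
  have : \sum_k F k <= #|{: 'I_m + 'I_n}|%:R * K.
    apply: (@le_trans _ _ (\sum_(k : 'I_m + 'I_n) K)); first exact: ler_sum.
    by rewrite sumr_const mulr_natl.
  by rewrite /S; lra.
have slopeB j : `|slope v j 0| <= B.
  have : `|slope v j 0| `^ q <= S / lam.
    rewrite ler_pdivlMr// mulrC; apply: le_trans penS; rewrite ler_pM2l//.
    by rewrite /bridge_penalty (bigD1 j)//= lerDl sumr_ge0// => *; exact: powR_ge0.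
  rewrite /B; have [le1|gt1] := leP `|slope v j 0| 1.
    by have := powR_ge0 `|slope v j 0| q; lra.
  have : `|slope v j 0| `^ 1 <= `|slope v j 0| `^ q by rewrite ler_powR ?ltW.
  by rewrite powRr1//; lra.
have B0 : 0 <= B by rewrite addr_ge0// divr_ge0 ?(ltW lam0)//; exact: le_trans penS.
have slope_h (g : 'cV[R]_d) : `|((slope v)^T *m g) 0 0| <= B * \sum_j `|g j 0|.
  rewrite mxE big_distrr/=; apply: (le_trans (ler_norm_sum _ _ _)); apply: ler_sum => j _.
  by rewrite mxE normrM ler_wpM2r.
rewrite le_max; case: (split_ordP i) => j ->; apply/orP; [right|left].
  rewrite ord1 (_ : v _ 0 = intercept v); last by rewrite /intercept mxE.
  have := slope_h (h (x1 (Ordinal m0))); have := slope_h (h (x2 (Ordinal n0))).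
  move: low up; rewrite /linpred /H big_split/= mulrDr.
  have s1 : 0 <= B * \sum_j `|h (x1 (Ordinal m0)) j 0| by rewrite mulr_ge0// sumr_ge0.
  have s2 : 0 <= B * \sum_j `|h (x2 (Ordinal n0)) j 0| by rewrite mulr_ge0// sumr_ge0.
  by rewrite !ler_norml => ? ? /andP[? ?] /andP[? ?]; apply/andP; split; lra.
by have := slopeB j; rewrite /slope mxE.
Qed.

Lemma penalized_mle_exists (R : realType) (d : nat) (h : R -> 'cV[R]_d)
    (q lam : R) (m n : nat) (x1 : 'I_m -> R) (x2 : 'I_n -> R) :
  (0 < m)%N -> (0 < n)%N -> 1 < q -> 0 < lam ->
  exists u, unique (maximizer (penalized_loglik h q lam x1 x2)) u.
Proof.
move=> m0 n0 q1 lam0.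
have [||u _ umax] := @coercive_attains_max _ _ _ setT (@continuous_penalized_loglik _ _ h q lam m n x1 x2 q1)
  (@coercive_penalized_loglik _ _ h q lam m n x1 x2 m0 n0 q1 lam0).
- exact: closedT.
- by exists 0.
exists u; split => [v|v vmax]; first exact: umax.
apply: (@strict_supergradients_unique_max _ _ (penalized_loglik h q lam x1 x2)) => //.
  exact: penalized_loglik_supergradients.
by move=> w; exact: umax.
Qed.

Lemma measurable_penalized_loglik (R : realType) (dsp : measure_display)
    (T : measurableType dsp) (d : nat) (h : R -> 'cV[R]_d) (q lam : R) (m n : nat)
    (X1 : T -> 'I_m -> R) (X2 : T -> 'I_n -> R) (v : 'cV[R]_(1 + d)) :
  (forall i : 'I_d, measurable_fun [set: R] (fun x => h x i 0)) ->
  (forall j, measurable_fun [set: T] (X1^~ j)) ->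
  (forall j, measurable_fun [set: T] (X2^~ j)) ->
  measurable_fun [set: T] (fun t => penalized_loglik h q lam (X1 t) (X2 t) v).
Proof.
move=> mh mX1 mX2; apply: measurable_funB => //.
rewrite (_ : (fun t => _) = fun t => \sum_k ((from_first k)%:R *
    linpred h v (pooled (X1 t) (X2 t) k)
    - ln (1 + m%:R / n%:R * expR (linpred h v (pooled (X1 t) (X2 t) k))))); last first.
  by apply/funext => t; exact: loglikE.
apply: measurable_sum => k.
have ml : measurable_fun [set: T] (fun t => linpred h v (pooled (X1 t) (X2 t) k)).
  apply: measurableT_comp; first exact: measurable_linpred.
  by case: k => j; [exact: mX1|exact: mX2].
apply: measurable_funB; first exact: measurable_funM.
apply: measurableT_comp; first exact: measurable_ln.
apply: measurable_funD => //; apply: measurable_funM => //.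
by apply: measurableT_comp => //; exact: measurable_expR.
Qed.

(** * Fluctuations of the score and of the empirical information *)

Lemma measurable_inv_pos (R : realType) (dsp : measure_display)
    (T : measurableType dsp) (f : T -> R) :
  measurable_fun [set: T] f -> (forall x, 0 < f x) ->
  measurable_fun [set: T] (fun x => (f x)^-1).
Proof.
move=> mf f0; rewrite (_ : (fun x => _) = fun x => expR (- ln (f x))); last first.
  by apply/funext => x; rewrite expRN lnK// posrE.
apply: measurableT_comp; first exact: measurable_expR.
by apply: measurableT_comp => //; apply: measurableT_comp => //; exact: measurable_ln.
Qed.

Lemma measurable_sigmoid_linpred (R : realType) (d : nat) (h : R -> 'cV[R]_d)
    (theta : 'cV[R]_(1 + d)) (rho : R) : 0 < rho ->
  (forall i : 'I_d, measurable_fun [set: R] (fun x => h x i 0)) ->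
  measurable_fun [set: R] (fun x => sigmoid rho (linpred h theta x)).
Proof.
move=> rho0 mh.
have ml := measurable_linpred theta mh.
have me : measurable_fun [set: R] (fun x => rho * expR (linpred h theta x)).
  by apply: measurable_funM => //; apply: measurableT_comp => //; exact: measurable_expR.
apply: measurable_funM => //.
apply: measurable_inv_pos => [|x]; first exact: measurable_funD.
by rewrite addr_gt0 ?mulr_gt0 ?expR_gt0.
Qed.

Section tail_bounds.
Context (R : realType) (dsp : measure_display) (T : measurableType dsp)
  (P : probability T R) (d : nat) (h : R -> 'cV[R]_d)
  (h_meas : forall i : 'I_d, measurable_fun [set: R] (fun x => h x i 0))
  (g1 g2 : R -> R) (G1 G2 : probability (measurableTypeR R) R)
  (g1_density : is_density g1 G1) (g2_density : is_density g2 G2)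
  (theta0 : 'cV[R]_(1 + d))
  (density_ratio : forall x, g1 x = expR (linpred h theta0 x) * g2 x)
  (m n : nat) (m0 : (0 < m)%N) (n0 : (0 < n)%N)
  (X1 : 'I_m -> {RV P >-> measurableTypeR R})
  (X2 : 'I_n -> {RV P >-> measurableTypeR R})
  (samples : two_samples G1 G2 X1 X2).

Let law (k : 'I_m + 'I_n) : probability (measurableTypeR R) R :=
  if from_first k then G1 else G2.

Let lawP k B : measurable B -> distribution P (pooled X1 X2 k) B = law k B.
Proof. by have [l1 l2 _] := samples; case: k => j mB; [exact: l1|exact: l2]. Qed.

(** With e the density ratio and p the sigmoid, p = rho e (1 - p).  The tilt turns
    the mean over the first sample into n1 E2[e (1 - p) z], and the mean over the
    second one is - n2 E2[p z], so they cancel since rho = n1 / n2.  Both second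
    moments are controlled by E2[e (1 - p) z^2], where e (1 - p) is at most three
    times the weight of A as soon as rho1 <= 2 rho. *)
Lemma score_tail (rho1 a : R) (i : 'I_(1 + d)) :
  0 < rho1 -> rho1 <= 2 * (m%:R / n%:R) ->
  finite_A_integrals h theta0 rho1 G2 -> 0 < a ->
  (P [set t | (a <= `|score h (fun j => X1 j t) (fun j => X2 j t) theta0 i|)%R]
    <= (6 * m%:R * matA h theta0 rho1 G2 i i / a ^+ 2)%:E)%E.
Proof.
move=> rho10 rhole Afin a0.
set rho := m%:R / n%:R in rhole.
have rho0 : 0 < rho by rewrite divr_gt0 ?ltr0n.
pose e x := expR (linpred h theta0 x).
pose z x := feature h x i 0.
pose p x := sigmoid rho (linpred h theta0 x).
pose wz x := weight h theta0 rho1 x * (z x * z x).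
have e0 x : 0 < e x by exact: expR_gt0.
have D0 x : 0 < 1 + rho * e x by have := e0 x; nra.
have D10 x : 0 < 1 + rho1 * e x by have := e0 x; nra.
have pE x : p x = rho * e x * (1 - p x).
  by rewrite /p /sigmoid -/(e x); field; rewrite gt_eqF ?D0 //.
have p01 x : 0 < p x < 1 by exact: sigmoid_itv.
have ep x : e x * (1 - p x) <= 3 * weight h theta0 rho1 x.
  have -> : e x * (1 - p x) = e x / (1 + rho * e x).
    by rewrite /p /sigmoid -/(e x); field; rewrite gt_eqF ?D0 //.
  rewrite /weight -/(e x) ler_pdivrMr// mulrA mulrAC ler_pdivlMr//.
  have ex := e0 x; have : rho1 * e x <= 2 * (rho * e x) by rewrite mulrA (ler_wpM2r (ltW ex)).
  have := e0 x.
  move=> ? ?; rewrite (_ : 3 * e x * _ = e x * (3 * (1 + rho * e x))); last by ring.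
  by rewrite ler_pM2l//; have := mulr_gt0 rho0 ex; lra.
have me : measurable_fun [set: R] e.
  by apply: measurableT_comp; [exact: measurable_expR|exact: measurable_linpred].
have mz : measurable_fun [set: R] z by exact: measurable_feature.
have mp : measurable_fun [set: R] p by exact: measurable_sigmoid_linpred.
pose f (k : 'I_m + 'I_n) x := ((from_first k)%:R - p x) * z x.
have mf k : measurable_fun [set: R] (f k).
  by apply: measurable_funM => //; apply: measurable_funB.
have iwz : G2.-integrable setT (fun x => (wz x)%:E) by exact: weighted_features_integrable.
have W : matA h theta0 rho1 G2 i i = \int[G2]_x wz x by exact: matAE.
have i3wz (c : R) : G2.-integrable setT (fun x => (c * wz x)%:E).
  exact: (integrableZl measurableT c iwz).
pose s (k : 'I_m + 'I_n) := (if from_first k then 3 else rho * 3) * \int[G2]_x wz x.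
have first_sq x : ((1 - p x) * z x) ^+ 2 * e x <= 3 * wz x.
  have -> : ((1 - p x) * z x) ^+ 2 * e x = (1 - p x) * (e x * (1 - p x)) * (z x * z x) by ring.
  rewrite /wz [3 * _]mulrA ler_wpM2r//; first by rewrite -expr2 sqr_ge0.
  apply: le_trans (ep x); have /andP[? ?] := p01 x; have ? := e0 x.
  by rewrite ler_piMl// ?mulr_ge0//; lra.
have second_sq x : (- p x * z x) ^+ 2 <= rho * 3 * wz x.
  have -> : (- p x * z x) ^+ 2 = p x * p x * (z x * z x) by ring.
  rewrite /wz [rho * 3 * _]mulrA ler_wpM2r//; first by rewrite -expr2 sqr_ge0.
  have /andP[? ?] := p01 x; apply: (@le_trans _ _ (p x)); first by rewrite ler_piMl//; lra.
  have := ep x; rewrite -(ler_pM2l rho0) {2}pE; lra.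
have isq2 : G2.-integrable setT (fun x => ((- p x * z x) ^+ 2)%:E).
  apply: (@Rintegrable_dominated _ (measurableTypeR R) R G2 _ _ _ _ (i3wz (rho * 3))).
    by apply: measurable_funX; apply: measurable_funM => //; exact: measurableT_comp.
  by move=> x; rewrite ger0_norm ?sqr_ge0// second_sq.
have isq1e : G2.-integrable setT (fun x => (((1 - p x) * z x) ^+ 2 * e x)%:E).
  apply: (@Rintegrable_dominated _ (measurableTypeR R) R G2 _ _ _ _ (i3wz 3)).
    apply: measurable_funM => //; apply: measurable_funX; apply: measurable_funM => //.
    exact: measurable_funB.
  by move=> x; rewrite ger0_norm ?first_sq// mulr_ge0 ?sqr_ge0// ltW.
have tilt := @integral_tilt R e g1 g2 G1 G2 _ g1_density g2_density density_ratio me (fun x => ltW (e0 x)).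
have msq1 : measurable_fun [set: R] (fun x => ((1 - p x) * z x) ^+ 2).
  by apply: measurable_funX; apply: measurable_funM => //; exact: measurable_funB.
have [isq1 sq1E] := tilt _ msq1 isq1e.
have if2 k : (law k).-integrable setT (fun x => (f k x ^+ 2)%:E).
  case: k => j; rewrite /law /f /=; first exact: isq1.
  by under [X in integrable _ _ X]eq_fun do rewrite sub0r; exact: isq2.
have fs k : \int[law k]_x (f k x ^+ 2) <= s k.
  case: k => j; rewrite /law /f /s /=.
    rewrite sq1E -(RintegralZl _ measurableT iwz).
    exact: (le_Rintegral measurableT isq1e (i3wz 3) (fun x _ => first_sq x)).
  rewrite -(RintegralZl _ measurableT iwz).
  have E x : (false%:R - p x) * z x = - p x * z x by rewrite sub0r.
  under [X in X <= _]eq_Rintegral do rewrite E.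
  exact: (le_Rintegral measurableT isq2 (i3wz (rho * 3)) (fun x _ => second_sq x)).
have mean0 : \sum_k \int[law k]_x f k x = 0.
  have ipz : G2.-integrable setT (fun x => (- p x * z x)%:E).
    apply: Rintegrable_of_sqr => //.
    by apply: measurable_funM => //; exact: measurableT_comp.
  have eE x : (1 - p x) * z x * e x = - rho^-1 * (- p x * z x).
    by rewrite [in RHS]pE; field; rewrite gt_eqF ?D0 //.
  have mpz : measurable_fun [set: R] (fun x => (1 - p x) * z x).
    by apply: measurable_funM => //; exact: measurable_funB.
  have iez : G2.-integrable setT (fun x => ((1 - p x) * z x * e x)%:E).
    under [X in integrable _ _ X]eq_fun do rewrite eE.
    exact: (integrableZl measurableT (- rho^-1) ipz).
  have [_ E1] := tilt _ mpz iez.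
  pose J := \int[G2]_x (- p x * z x).
  have EJ1 : \int[G1]_x ((1 - p x) * z x) = - rho^-1 * J.
    by rewrite E1; under eq_Rintegral do rewrite eE; exact: (RintegralZl _ measurableT ipz).
  have EJ2 : \int[G2]_x ((false%:R - p x) * z x) = J.
    by apply: eq_Rintegral => x _; rewrite sub0r.
  rewrite big_sumType/= /law /f /= !sumr_const !card_ord EJ1 EJ2.
  have [mN0 nN0] : m%:R != 0 :> R /\ n%:R != 0 :> R by rewrite !pnatr_eq0 -!lt0n.
  rewrite -[X in X + _]mulr_natl -[X in _ + X]mulr_natl /rho; move: J {EJ1 EJ2} => J.
  by field; rewrite mN0 nN0.
have sums : \sum_k s k = 6 * m%:R * matA h theta0 rho1 G2 i i.
  rewrite big_sumType/= /s /= !sumr_const !card_ord W.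
  rewrite -[X in X + _]mulr_natl -[X in _ + X]mulr_natl /rho.
  by field; rewrite pnatr_eq0 gtn_eqF.
have [_ _ indep] := samples.
have := chebyshev_indep_sum indep lawP mf if2 fs a0.
rewrite sums; congr (P _ <= _)%E; apply/funext => t /=.
rewrite sumrB mean0 subr0 /score; congr (a <= `|_|).
by apply: eq_bigr => -[] j _.
Qed.

(** The factor e / (1 + e)^2 is, up to a constant depending on rho, a lower bound
    for p (1 - p).  Division by (1 + |z|)^2 bounds the entries of v z z' by 1, so
    that they have finite variance without any moment assumption on h; at the
    same time it absorbs the factor 1 + |u'z| of the curvature
    ([curvature_info]). *)
Definition info_weight (x : R) : R :=
  expR (linpred h theta0 x) / (1 + expR (linpred h theta0 x)) ^+ 2
   / (1 + \sum_i `|feature h x i 0|) ^+ 2.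

Definition info (i j : 'I_(1 + d)) (x : R) : R :=
  info_weight x * (feature h x i 0 * feature h x j 0).

Lemma info_weight_gt0 x : 0 < info_weight x.
Proof.
have e0 : 0 < expR (linpred h theta0 x) by exact: expR_gt0.
apply: divr_gt0; last by rewrite exprn_gt0// ltr_pwDl// sumr_ge0.
by apply: divr_gt0 => //; rewrite exprn_gt0// addr_gt0.
Qed.

Lemma measurable_info i j : measurable_fun [set: R] (info i j).
Proof.
have ml := measurable_linpred theta0 h_meas.
have mz := measurable_feature h_meas.
have me : measurable_fun [set: R] (fun x => expR (linpred h theta0 x)).
  by apply: measurableT_comp => //; exact: measurable_expR.
apply: measurable_funM; last by apply: measurable_funM; exact: mz.
apply: measurable_funM; first apply: measurable_funM => //.
  apply: measurable_inv_pos => [|x]; first by apply: measurable_funX; exact: measurable_funD.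
  by rewrite exprn_gt0// addr_gt0 ?expR_gt0.
apply: measurable_inv_pos => [|x]; last by rewrite exprn_gt0// ltr_pwDl ?sumr_ge0.
apply: measurable_funX; apply: measurable_funD => //.
by apply: measurable_sum => k; apply: measurableT_comp => //; exact: mz.
Qed.

Lemma info_le1 i j x : `|info i j x| <= 1.
Proof.
have e0 : 0 < expR (linpred h theta0 x) by exact: expR_gt0.
set e := expR _ in e0; set N := \sum_k `|feature h x k 0|.
have N0 : 0 <= N by exact: sumr_ge0.
have zN k : `|feature h x k 0| <= N by rewrite /N (bigD1 k)//= lerDl sumr_ge0.
rewrite /info normrM gtr0_norm ?info_weight_gt0// normrM.
apply: (@le_trans _ _ (info_weight x * (1 + N) ^+ 2)).
  rewrite (ler_wpM2l (ltW (info_weight_gt0 x)))// expr2.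
  by rewrite ler_pM//; have := zN i; have := zN j; lra.
rewrite /info_weight -/e -/N divfK ?expf_neq0 ?gt_eqF ?ltr_pwDl//.
by rewrite ler_pdivrMr ?mul1r ?exprn_gt0 ?addr_gt0//; nra.
Qed.

Lemma info_integrable i j : G2.-integrable setT (fun x => (info i j x)%:E).
Proof.
apply: (@Rintegrable_dominated _ (measurableTypeR R) R G2 _ (fun=> 1)).
- exact: measurable_info.
- exact: info_le1.
- exact: Rintegrable_cst.
Qed.

Lemma info_tail (a : R) (i j : 'I_(1 + d)) : 0 < a ->
  (P [set t | (a <= `|\sum_(k < n) info i j (X2 k t) - n%:R * \int[G2]_x info i j x|)%R]
    <= (n%:R / a ^+ 2)%:E)%E.
Proof.
move=> a0.
pose f (k : 'I_m + 'I_n) x := if from_first k then 0 else info i j x.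
pose s (k : 'I_m + 'I_n) : R := if from_first k then 0 else 1.
have mf k : measurable_fun [set: R] (f k).
  by case: k => l; rewrite /f /=; [exact: measurable_cst|exact: measurable_info].
have sq1 k x : f k x ^+ 2 <= s k.
  case: k => l; rewrite /f /s /= ?expr0n//.
  by rewrite -real_normK ?num_real// expr_le1// info_le1.
have if2 k : (law k).-integrable setT (fun x => (f k x ^+ 2)%:E).
  apply: (@Rintegrable_dominated _ (measurableTypeR R) R (law k) _ (fun=> s k)).
  - by apply: measurable_funX; exact: mf.
  - by move=> x; rewrite ger0_norm ?sqr_ge0.
  - exact: Rintegrable_cst.
have fs k : \int[law k]_x (f k x ^+ 2) <= s k.
  apply: (@le_trans _ _ (\int[law k]_x s k)).
    exact: (le_Rintegral measurableT (if2 k) (Rintegrable_cst (law k) (s k)) (fun x _ => sq1 k x)).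
  rewrite Rintegral_cst// -[leRHS]mulr1 le_eqVlt; apply/orP; left; apply/eqP.
  congr (_ * _); exact: (congr1 fine (probability_setT (law k))).
have [_ _ indep] := samples.
have := chebyshev_indep_sum indep lawP mf if2 fs a0.
have -> : \sum_k s k = n%:R.
  by rewrite big_sumType/= /s /= big1// add0r sumr_const card_ord.
have E1 : \sum_k \int[law k]_x f k x = n%:R * \int[G2]_x info i j x.
  rewrite big_sumType/= /law /f /= big1.
    by rewrite add0r sumr_const card_ord mulr_natl.
  by move=> l _; rewrite Rintegral_cst// mul0r.
congr (P _ <= _)%E; apply/funext => t /=; congr (a <= `|_|).
by rewrite sumrB E1 big_sumType/= /f /= big1 ?add0r.
Qed.

End tail_bounds.

(** * Positive definiteness and the deterministic rate bound *)

Section information_matrix.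
Context (R : realType) (d : nat) (h : R -> 'cV[R]_d)
  (h_meas : forall i : 'I_d, measurable_fun [set: R] (fun x => h x i 0))
  (G2 : probability (measurableTypeR R) R) (theta0 : 'cV[R]_(1 + d)).

Let Q (u : 'cV[R]_(1 + d)) : R :=
  \sum_i \sum_j u i 0 * u j 0 * \int[G2]_x info h theta0 i j x.

Let dot (u : 'cV[R]_(1 + d)) (x : R) : R := \sum_i u i 0 * feature h x i 0.

Lemma info_quadratic (u : 'cV[R]_(1 + d)) (x : R) :
  \sum_i \sum_j u i 0 * u j 0 * info h theta0 i j x = info_weight h theta0 x * dot u x ^+ 2.
Proof.
rewrite expr2 /dot big_distrl big_distrr/=; apply: eq_bigr => i _.
by rewrite !big_distrr/=; apply: eq_bigr => j _; rewrite /info; ring.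
Qed.

Let iq (u : 'cV[R]_(1 + d)) i j :
  G2.-integrable setT (fun x => (u i 0 * u j 0 * info h theta0 i j x)%:E).
Proof. exact: (integrableZl measurableT (u i 0 * u j 0) (info_integrable h_meas G2 theta0 i j)). Qed.

Let iqs (u : 'cV[R]_(1 + d)) i :
  G2.-integrable setT (fun x => (\sum_j u i 0 * u j 0 * info h theta0 i j x)%:E).
Proof.
under eq_fun do rewrite -sumEFin.
by apply: integrable_sum => // j _; exact: iq.
Qed.

Let iQ (u : 'cV[R]_(1 + d)) :
  G2.-integrable setT (fun x => (info_weight h theta0 x * dot u x ^+ 2)%:E).
Proof.
under eq_fun do rewrite -info_quadratic -sumEFin.
by apply: integrable_sum => // i _; exact: iqs.
Qed.

Let QE (u : 'cV[R]_(1 + d)) : Q u = \int[G2]_x (info_weight h theta0 x * dot u x ^+ 2).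
Proof.
under eq_Rintegral do rewrite -info_quadratic.
rewrite Rintegral_sum; last by move=> i; exact: iqs.
apply: eq_bigr => i _; rewrite Rintegral_sum; last by move=> j; exact: iq.
apply: eq_bigr => j _; rewrite RintegralZl//; exact: info_integrable.
Qed.

(** The form is the integral of v (u'z)^2 with v > 0.  If it vanishes, u'z = 0
    almost everywhere, whence A u = 0 and u = 0. *)
Lemma info_form_gt0 (rho1 : R) (u : 'cV[R]_(1 + d)) :
  finite_A_integrals h theta0 rho1 G2 -> matA h theta0 rho1 G2 \in unitmx ->
  u != 0 -> 0 < Q u.
Proof.
move=> Afin Aunit u0.
have v0 x : 0 < info_weight h theta0 x by exact: info_weight_gt0.
have q0 x : 0 <= info_weight h theta0 x * dot u x ^+ 2.
  by rewrite mulr_ge0 ?sqr_ge0// ltW.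
have Qge0 : 0 <= Q u by rewrite QE; exact: Rintegral_ge0.
rewrite lt_neqAle Qge0 andbT eq_sym; apply: contra u0 => /eqP Q0.
have ae0 : ae_eq G2 setT (fun x => (info_weight h theta0 x * dot u x ^+ 2)%:E) (cst 0%E).
  apply/(ae_eq_integral_abs G2 measurableT (measurable_int G2 (iQ u))).
  under eq_integral => x _ do rewrite gee0_abs ?lee_fin//.
  rewrite -[LHS](fineK (integrable_fin_num measurableT (iQ u))).
  by move: Q0; rewrite QE /Rintegral => ->.
have dot0 : {ae G2, forall x, dot u x = 0}.
  apply: filterS ae0 => x /(_ Logic.I) [] /eqP.
  by rewrite mulf_eq0 gt_eqF//= sqrf_eq0 => /eqP.
have iw i j := weighted_features_integrable i j Afin.
have Au0 : matA h theta0 rho1 G2 *m u = 0.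
  apply/colP => j; rewrite mxE [in RHS]mxE.
  under eq_bigr do rewrite matAE mulrC.
  have iwu i : G2.-integrable setT (fun x =>
      (u i 0 * (weight h theta0 rho1 x * (feature h x j 0 * feature h x i 0)))%:E).
    exact: (integrableZl measurableT (u i 0) (iw j i)).
  transitivity (\int[G2]_x \sum_i (u i 0 *
      (weight h theta0 rho1 x * (feature h x j 0 * feature h x i 0)))).
    rewrite Rintegral_sum//; apply: eq_bigr => i _.
    by rewrite (RintegralZl _ measurableT (iw j i)).
  rewrite /Rintegral (@ae_eq_integral _ _ _ G2 setT (cst 0%E))//.
  - by rewrite integral0.
  - apply: (measurable_int G2); under eq_fun do rewrite -sumEFin.
    by apply: integrable_sum => // i _; exact: iwu.
  - apply: (@filterS _ _ (ae_filter_ringOfSetsType G2) _ _ _ dot0) => x dx _ /=; congr EFin.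
    transitivity (weight h theta0 rho1 x * feature h x j 0 * dot u x).
      by rewrite /dot big_distrr/=; apply: eq_bigr => i _; ring.
    by rewrite dx mulr0.
by rewrite -[u](mulKmx Aunit) Au0 mulmx0.
Qed.

(** Compactness of the l1 unit sphere and homogeneity. *)
Lemma info_positive_definite (rho1 : R) :
  finite_A_integrals h theta0 rho1 G2 -> matA h theta0 rho1 G2 \in unitmx ->
  exists2 kappa, 0 < kappa & forall u : 'cV[R]_(1 + d),
    kappa * (\sum_i `|u i 0|) ^+ 2 <= Q u.
Proof.
move=> Afin Aunit.
pose N (u : 'cV[R]_(1 + d)) : R := \sum_i `|u i 0|.
have N0 u : 0 <= N u by exact: sumr_ge0.
have cN : continuous N.
  apply: continuous_sumr => i u.
  apply: (@continuous_comp _ _ _ (fun v : 'cV[R]_(1 + d) => v i 0) (fun y : R => `|y|)).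
    exact: coord_continuous.
  exact: norm_continuous.
have cQ : continuous Q.
  apply: continuous_sumr => i; apply: continuous_sumr => j u.
  apply: (@continuousM _ _ (fun v : 'cV[R]_(1 + d) => v i 0 * v j 0) (cst _)).
    by apply: continuousM; exact: coord_continuous.
  exact: cst_continuous.
pose D := [set u : 'cV[R]_(1 + d) | N u = 1].
have Dcl : closed D.
  exact: (@preimage_closed _ _ N [set 1] (fun v _ => cN v) (@closed_eq _ 1)).
have Dco : compact D.
  apply: (subclosed_compact Dcl (@cV_box_compact R (1 + d) 1)) => u /= uD i.
  by rewrite -uD /N (bigD1 i)//= lerDl sumr_ge0.
have D0 : D !=set0.
  exists (\col_i (i == ord0)%:R); rewrite /D /= /N (bigD1 ord0)//= mxE eqxx normr1 big1 ?addr0//.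
  by move=> i /negbTE i0; rewrite mxE i0 normr0.
have [u0 u0D umin] := @compact_EVT_min _ _ Q D D0 Dco (continuous_subspaceT cQ).
move: u0D; rewrite inE => u0D.
have kappa0 : 0 < Q u0.
  apply: (info_form_gt0 Afin Aunit); apply/eqP => E; move: u0D.
  by rewrite /D /= /N E big1 => [|i _]; [lra|rewrite mxE normr0].
exists (Q u0) => // u.
have [->|uN0] := eqVneq u 0.
  rewrite (_ : \sum_i _ = 0) ?expr0n ?mulr0; last first.
    by rewrite big1// => i _; rewrite mxE normr0.
  by rewrite QE; apply: Rintegral_ge0 => x _; rewrite mulr_ge0 ?sqr_ge0// ltW// info_weight_gt0.
have Nu : 0 < N u.
  rewrite lt_neqAle N0 andbT eq_sym; apply: contra uN0 => /eqP Nu0.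
  apply/eqP/colP => i; rewrite mxE; apply/eqP; rewrite -normr_eq0 eq_le normr_ge0 andbT.
  by rewrite -Nu0 /N (bigD1 i)//= lerDl sumr_ge0.
pose w := (N u)^-1 *: u.
have wD : D w.
  rewrite /D /= /N; under eq_bigr do rewrite mxE normrM.
  by rewrite -big_distrr/= gtr0_norm ?invr_gt0// -/(N u) mulVf// gt_eqF.
have -> : Q u = Q w * N u ^+ 2.
  rewrite /Q big_distrl/=; apply: eq_bigr => i _; rewrite big_distrl/=; apply: eq_bigr => j _.
  by rewrite !mxE; field; rewrite gt_eqF.
by rewrite ler_wpM2r ?sqr_ge0//; apply: umin; rewrite inE.
Qed.

End information_matrix.

Lemma bridge_penalty_lower (R : realType) (d : nat) (q : R) (b0 : 'cV[R]_d) :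
  1 < q -> exists2 L, 0 <= L & forall b : 'cV[R]_d,
    bridge_penalty q b0 - L * \sum_j `|b j 0 - b0 j 0| <= bridge_penalty q b.
Proof.
move=> q1; have [s sP] := bridge_penalty_tangent b0 q1.
exists (\sum_j `|s j|) => [|b]; first exact: sumr_ge0.
apply: le_trans (sP b).1; rewrite lerD2l lerNl -sumrN.
apply: (@le_trans _ _ (\sum_j `|s j| * `|b j 0 - b0 j 0|)).
  by apply: ler_sum => j _; rewrite -normrM -normrN ler_norm.
rewrite big_distrl/=; apply: ler_sum => j _; rewrite ler_wpM2l//.
by rewrite (bigD1 j)//= lerDl sumr_ge0.
Qed.

(** Uses 1 + rho e <= (1 + rho) (1 + e) and, in l1 norms,
    1 + |u'z| <= (1 + |u|) (1 + |z|). *)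
Lemma curvature_info (R : realType) (d : nat) (h : R -> 'cV[R]_d)
    (theta0 u : 'cV[R]_(1 + d)) (rho x : R) : 0 < rho ->
  rho / (1 + rho) ^+ 2 * (info_weight h theta0 x * (\sum_i u i 0 * feature h x i 0) ^+ 2)
    / (2 * (1 + \sum_i `|u i 0|))
  <= curvature rho (linpred h theta0 x) (\sum_i u i 0 * feature h x i 0).
Proof.
move=> rho0; rewrite /curvature /info_weight /sigmoid.
set e := expR _; set N := \sum_i `|feature h x i 0|; set r := \sum_i `|u i 0|.
set dl := \sum_i u i 0 * _.
have e0 : 0 < e by exact: expR_gt0.
have N0 : 0 <= N by exact: sumr_ge0.
have r0 : 0 <= r by exact: sumr_ge0.
have dlN : `|dl| <= r * N.
  rewrite /r big_distrl/=; apply: (le_trans (ler_norm_sum _ _ _)); apply: ler_sum => i _.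
  by rewrite normrM ler_wpM2l// /N (bigD1 i)//= lerDl sumr_ge0.
have re0 : 0 < rho * e by rewrite mulr_gt0.
have -> : rho * e / (1 + rho * e) * (1 - rho * e / (1 + rho * e)) = rho * e / (1 + rho * e) ^+ 2.
  by field; rewrite gt_eqF// addr_gt0.
have d0 : 0 < 1 + `|dl| by rewrite ltr_pwDl.
rewrite (_ : _ / _ = (rho * e / ((1 + rho) ^+ 2 * (1 + e) ^+ 2)) *
   (dl ^+ 2 / (2 * ((1 + r) * (1 + N) ^+ 2)))); last first.
  have [n1 n2] : 1 + rho != 0 /\ 1 + e != 0 by rewrite !gt_eqF ?addr_gt0.
  have [n3 n4] : 1 + N != 0 /\ 1 + r != 0 by rewrite !gt_eqF ?ltr_pwDl.
  by field; rewrite n1 n2 n3 n4.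
rewrite ler_pM//.
- by rewrite divr_ge0 ?(ltW re0)// mulr_ge0 ?sqr_ge0.
- by rewrite divr_ge0 ?sqr_ge0// !mulr_ge0 ?sqr_ge0// addr_ge0.
- rewrite ler_pM2l// lef_pV2 ?posrE ?mulr_gt0 ?exprn_gt0 ?addr_gt0//.
  by rewrite -exprMn ler_sqr ?nnegrE ?mulr_ge0 ?addr_ge0 ?(ltW rho0) ?(ltW e0) ?(ltW re0)//; nra.
- rewrite ler_wpM2l ?sqr_ge0// lef_pV2 ?posrE ?mulr_gt0 ?exprn_gt0 ?ltr_pwDl//.
  rewrite ler_pM2l//; apply: (@le_trans _ _ ((1 + r) * (1 + N))); first nra.
  by rewrite ler_wpM2l ?addr_ge0// expr2; nra.
Qed.

(** The gain S'u and the variation of the penalty are at most (S + lam L) r, and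
    they must compensate the curvature, which is at least a multiple of
    n kappa r^2 / (1 + r): replacing the empirical matrix by n M costs at most
    half of n kappa r^2. *)
Lemma rate_bound (R : realType) (d : nat) (h : R -> 'cV[R]_d)
    (theta0 theta : 'cV[R]_(1 + d)) (q lam L S kappa : R) (m n : nat)
    (x1 : 'I_m -> R) (x2 : 'I_n -> R) (M : 'I_(1 + d) -> 'I_(1 + d) -> R) :
  (0 < m)%N -> (0 < n)%N -> 0 <= lam -> 0 <= L ->
  (forall b : 'cV[R]_d,
    bridge_penalty q (slope theta0) - L * \sum_j `|b j 0 - slope theta0 j 0|
      <= bridge_penalty q b) ->
  (forall u : 'cV[R]_(1 + d), kappa * (\sum_i `|u i 0|) ^+ 2
      <= \sum_i \sum_j u i 0 * u j 0 * M i j) ->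
  (forall i, `|score h x1 x2 theta0 i| <= S) ->
  (forall i j, `|\sum_k info h theta0 i j (x2 k) - n%:R * M i j| <= n%:R * (kappa / 2)) ->
  penalized_loglik h q lam x1 x2 theta0 <= penalized_loglik h q lam x1 x2 theta ->
  m%:R / n%:R / (1 + m%:R / n%:R) ^+ 2 * n%:R * kappa * (\sum_i `|theta i 0 - theta0 i 0|)
    <= 4 * (1 + \sum_i `|theta i 0 - theta0 i 0|) * (S + lam * L).
Proof.
move=> m0 n0 lam0 L0 penL posM scS infoM better.
set r := \sum_i `|_|; set rho := m%:R / n%:R.
have rho0 : 0 < rho by rewrite divr_gt0 ?ltr0n.
pose u := theta - theta0.
have uE i : u i 0 = theta i 0 - theta0 i 0 by rewrite !mxE.
have r0 : 0 <= r by exact: sumr_ge0.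
have rE : r = \sum_i `|u i 0| by apply: eq_bigr => i _; rewrite uE.
have gap := loglik_gap h x1 x2 theta theta0 m0 n0.
have pen := penL (slope theta).
have pen_r : \sum_j `|slope theta j 0 - slope theta0 j 0| <= r.
  rewrite /r big_split_ord/= ler_wpDl ?sumr_ge0//.
  by apply: ler_sum => j _; rewrite /slope !mxE.
have scr : \sum_i score h x1 x2 theta0 i * (theta i 0 - theta0 i 0) <= S * r.
  rewrite /r big_distrr/=; apply: ler_sum => i _.
  by rewrite (le_trans (ler_norm _))// normrM ler_wpM2r.
set c := rho / (1 + rho) ^+ 2.
have c0 : 0 < c by rewrite divr_gt0// exprn_gt0// addr_gt0.
have second : c * (\sum_(k < n) info_weight h theta0 (x2 k) *
      (\sum_i u i 0 * feature h (x2 k) i 0) ^+ 2) / (2 * (1 + r))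
   <= \sum_k curvature rho (linpred h theta0 (pooled x1 x2 k))
       (\sum_i (theta i 0 - theta0 i 0) * feature h (pooled x1 x2 k) i 0).
  rewrite big_sumType/= ler_wpDl ?sumr_ge0//; first by move=> *; exact: curvature_ge0.
  rewrite big_distrr big_distrl/=; apply: ler_sum => k _; rewrite rE.
  have := curvature_info h theta0 u (x2 k) rho0.
  by under [X in curvature _ _ X]eq_bigr do rewrite uE.
have quad : n%:R * (kappa / 2) * r ^+ 2 <= \sum_(k < n) info_weight h theta0 (x2 k) *
      (\sum_i u i 0 * feature h (x2 k) i 0) ^+ 2.
  under eq_bigr do rewrite -info_quadratic.
  rewrite exchange_big/=.
  under eq_bigr do rewrite exchange_big/=.
  have -> : n%:R * (kappa / 2) * r ^+ 2 = n%:R * (kappa * r ^+ 2) - n%:R * (kappa / 2) * r ^+ 2.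
    by field.
  apply: (@le_trans _ _ (n%:R * (\sum_i \sum_j u i 0 * u j 0 * M i j) - n%:R * (kappa / 2) * r ^+ 2)).
    by rewrite lerD2r ler_wpM2l// rE.
  rewrite lerBlDr -lerBlDl.
  rewrite big_distrr/= -sumrB expr2 {1}rE big_distrl [leRHS]big_distrr/=; apply: ler_sum => i _.
  rewrite big_distrr/= -sumrB rE big_distrr [leRHS]big_distrr/=; apply: ler_sum => j _.
  rewrite -big_distrr/= mulrCA -mulrBr (le_trans (ler_norm _))// !normrM mulrC.
  by rewrite ler_wpM2r ?mulr_ge0// distrC.
have main : c * (n%:R * (kappa / 2) * r ^+ 2) / (2 * (1 + r)) <= r * (S + lam * L).
  apply: (@le_trans _ _ (c * (\sum_(k < n) info_weight h theta0 (x2 k) *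
      (\sum_i u i 0 * feature h (x2 k) i 0) ^+ 2) / (2 * (1 + r)))).
    by rewrite ler_pM2r ?invr_gt0 ?mulr_gt0 ?ltr_pwDl// ler_pM2l.
  have p1 : lam * (bridge_penalty q (slope theta0) - bridge_penalty q (slope theta)) <= lam * (L * r).
    by rewrite ler_wpM2l// lerBlDr -lerBlDl (le_trans _ pen)// lerD2l lerN2 ler_wpM2l.
  move: better; rewrite /penalized_loglik; lra.
move: main; rewrite ler_pdivrMr ?mulr_gt0 ?ltr_pwDl// => main.
have [r_eq0|r_neq0] := eqVneq r 0.
  have S0 : 0 <= S by rewrite (le_trans _ (scS ord0)).
  by rewrite r_eq0 mulr0 addr0 mulr1 mulr_ge0// addr_ge0 ?mulr_ge0.
have r_gt0 : 0 < r by rewrite lt_neqAle eq_sym r_neq0.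
rewrite -(ler_pM2r r_gt0); lra.
Qed.

(** * From tail bounds to rates in probability *)

Section tail_events.
Context (dsp : measure_display) (T : measurableType dsp) (R : realType)
  (P : probability T R).

Lemma measurable_ge (f : T -> R) (c : R) :
  measurable_fun [set: T] f -> measurable [set t | c <= f t].
Proof. by move=> mf; rewrite -[X in measurable X]setTI; exact: measurable_fun_le. Qed.

Lemma measurable_gt (f : T -> R) (c : R) :
  measurable_fun [set: T] f -> measurable [set t | c < f t].
Proof.
move=> mf; rewrite (_ : [set t | c < f t] = ~` [set t | f t <= c]).
  apply: measurableC; rewrite -[X in measurable X]setTI.
  exact: measurable_fun_le.
by apply/seteqP; split => t /=; [rewrite ltNge => /negP|move/negP; rewrite -ltNge].
Qed.

Lemma union_bound (I : finType) (A : I -> set T) : (forall i, measurable (A i)) ->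
  measurable [set t | exists i, A i t] /\
  (P [set t | exists i, A i t] <= \sum_i P (A i))%E.
Proof.
move=> mA.
have H (s : seq I) : measurable [set t | exists2 i, i \in s & A i t] /\
    (P [set t | exists2 i, i \in s & A i t] <= \sum_(i <- s) P (A i))%E.
  elim: s => [|i s [ms Ps]].
    rewrite (_ : mkset _ = set0) ?measure0 ?big_nil//.
    by apply/seteqP; split => t // -[].
  rewrite (_ : mkset _ = A i `|` [set t | exists2 i, i \in s & A i t]); last first.
    apply/seteqP; split => t /=.
      by move=> [j]; rewrite inE => /predU1P[->|js] Aj; [left|right; exists j].
    by case=> [Ai|[j js Aj]]; [exists i; rewrite ?mem_head|exists j; rewrite // inE js orbT].
  split; first exact: measurableU.
  by rewrite big_cons (le_trans (measureU2 _ _ _))// leeD2l.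
have -> : [set t | exists i, A i t] = [set t | exists2 i, i \in index_enum I & A i t].
  by apply/seteqP; split => t /= [i]; [exists i; rewrite ?mem_index_enum|move=> _; exists i].
exact: H.
Qed.

End tail_events.

Lemma enorm_le_sum (R : realType) (n : nat) (v : 'cV[R]_n) :
  enorm v <= \sum_i `|v i 0|.
Proof.
have S0 : 0 <= \sum_i `|v i 0| by exact: sumr_ge0.
rewrite /enorm -[leRHS]ger0_norm// -sqrtr_sqr ler_sqrt ?sqr_ge0//.
rewrite expr2 big_distrl/=; apply: ler_sum => i _.
rewrite -[_ ^+ 2]real_normK ?num_real// expr2 ler_wpM2l//.
by rewrite (bigD1 i)//= lerDl sumr_ge0.
Qed.

Lemma measurable_enorm (dsp : measure_display) (T : measurableType dsp)
    (R : realType) (n : nat) (Z : T -> 'cV[R]_n) (v : 'cV[R]_n) :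
  measurable_vector Z -> measurable_fun [set: T] (fun t => enorm (Z t - v)).
Proof.
move=> mZ; apply: measurableT_comp.
  by apply: continuous_measurable_fun; exact: sqrt_continuous.
apply: measurable_sum => i; apply: measurable_funX.
under eq_fun do rewrite !mxE.
by apply: measurable_funB => //; exact: mZ.
Qed.

Lemma bigO_in_probability_consistent (dsp : measure_display)
    (T : measurableType dsp) (R : realType) (P : probability T R) (n : nat)
    (Z : nat -> T -> 'cV[R]_n) (v : 'cV[R]_n) (a : nat -> R) :
  (forall k, measurable_vector (Z k)) -> a @ \oo --> (0 : R) ->
  bigO_in_probability P (fun k t => enorm (Z k t - v)) a -> consistent P Z v.
Proof.
move=> mZ a0 Oa eps eps0.
have me k c : measurable [set t | c < enorm (Z k t - v)].
  by apply: measurable_gt; exact: measurable_enorm.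
apply/fine_cvgP; split; first by near=> k; exact: fin_num_measure.
apply/cvgrPdist_le => e e0.
have [M M0 MO] := Oa e e0.
have small : \forall k \near \oo, M * a k <= eps.
  have : (fun k => M * a k) @ \oo --> M * 0 by apply: cvgM => //; exact: cvg_cst.
  rewrite mulr0 => /cvgrPdist_le/(_ eps eps0); apply: filterS => k.
  by rewrite sub0r normrN; apply: le_trans; exact: ler_norm.
near=> k.
rewrite sub0r normrN /= ger0_norm ?fine_ge0// -lee_fin fineK ?fin_num_measure//.
apply: le_trans (_ : (P [set t | (M * a k < `|enorm (Z k t - v)|)%R] <= _)%E); last by near: k.
have sk : M * a k <= eps by near: k.
have en t : `|enorm (Z k t - v)| = enorm (Z k t - v) by rewrite ger0_norm// sqrtr_ge0.
apply: le_measure; rewrite ?inE; [exact: me| |].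
  by under eq_set do rewrite en; exact: me.
by move=> t /=; rewrite en; exact: le_lt_trans.
Unshelve. all: end_near. Qed.

Lemma measurable_score (R : realType) (dsp : measure_display)
    (T : measurableType dsp) (d : nat) (h : R -> 'cV[R]_d) (m n : nat)
    (X1 : T -> 'I_m -> R) (X2 : T -> 'I_n -> R) (theta : 'cV[R]_(1 + d)) i :
  (0 < m)%N -> (0 < n)%N ->
  (forall i : 'I_d, measurable_fun [set: R] (fun x => h x i 0)) ->
  (forall j, measurable_fun [set: T] (X1^~ j)) ->
  (forall j, measurable_fun [set: T] (X2^~ j)) ->
  measurable_fun [set: T] (fun t => score h (X1 t) (X2 t) theta i).
Proof.
move=> m0 n0 mh mX1 mX2; rewrite /score; apply: measurable_sum => k.
have mX : measurable_fun [set: T] (fun t => pooled (X1 t) (X2 t) k).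
  by case: k => j; [exact: mX1|exact: mX2].
have rho0 : 0 < m%:R / n%:R :> R by rewrite divr_gt0 ?ltr0n.
apply: measurable_funM; last exact: (measurableT_comp (measurable_feature mh i) mX).
apply: measurable_funB => //.
exact: (measurableT_comp (measurable_sigmoid_linpred theta rho0 mh) mX).
Qed.

(** Dividing by 1 + r, the bound reads r / (1 + r) <= 4 B / (c sN); its right-hand
    side is at most 1 / 2, so that 1 + r is at most 2. *)
Lemma solve_rate_inequality (R : realType) (rho rho1 n sN kappa B S r : R) :
  0 < rho1 -> rho1 / 2 <= rho -> rho <= 2 * rho1 -> 0 < n -> 0 < kappa -> 0 < sN ->
  sN * sN = (1 + rho) * n -> 0 <= r -> S <= B * sN ->
  rho / (1 + rho) ^+ 2 * n * kappa * r <= 4 * (1 + r) * S ->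
  8 * B <= rho1 / 2 / (1 + 2 * rho1) ^+ 3 * kappa * sN ->
  r <= 8 * B / (rho1 / 2 / (1 + 2 * rho1) ^+ 3 * kappa) * sN^-1.
Proof.
move=> rho10 rho_ge rho_le n0 kappa0 sN0 sN2 r0 SB bound.
set c := rho1 / 2 / _ * kappa => big.
have rho1h : 0 < rho1 / 2 by rewrite divr_gt0.
have rho0 : 0 < rho by exact: lt_le_trans rho_ge.
have p1 : 0 < 1 + rho by rewrite addr_gt0.
have p2 : 0 < 1 + 2 * rho1 by rewrite addr_gt0 ?mulr_gt0.
have c0 : 0 < c by rewrite /c mulr_gt0// divr_gt0// exprn_gt0.
have cN : c * (sN * sN) <= rho / (1 + rho) ^+ 2 * n * kappa.
  rewrite sN2 (_ : rho / (1 + rho) ^+ 2 * n * kappa =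
    rho / (1 + rho) ^+ 3 * kappa * ((1 + rho) * n)); last first.
    by field; rewrite gt_eqF.
  rewrite ler_pM2r ?mulr_gt0// ler_pM2r// ler_pM// ?(ltW rho1h)//.
    by rewrite invr_ge0 exprn_ge0 ?ltW.
  by rewrite lef_pV2 ?posrE ?exprn_gt0// lerXn2r ?nnegrE ?(ltW p1) ?(ltW p2)// lerD2l.
have r10 : 0 <= 4 * (1 + r) by rewrite mulr_ge0// addr_ge0.
have main : c * (sN * sN) * r <= 4 * (1 + r) * (B * sN).
  apply: le_trans (ler_wpM2r r0 cN) _; apply: (le_trans bound).
  exact: ler_wpM2l.
have main2 : c * sN * r <= 4 * (1 + r) * B.
  rewrite -(ler_pM2r sN0); rewrite [leLHS](_ : _ = c * (sN * sN) * r); last by ring.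
  by rewrite -[leRHS]mulrA.
have r8 : 8 * B * r <= c * sN * r by rewrite ler_wpM2r.
rewrite -[leRHS]mulrA -invfM (ler_pdivlMr _ _ (mulr_gt0 c0 sN0)).
move: main2 r8; rewrite [r * _]mulrC; move: (c * sN * r) => x; lra.
Qed.

(** Outside the union of the events where a coordinate of the score exceeds
    K sqrt n, or an entry of the weighted empirical matrix is off its mean by
    n2 kappa / 2, the deterministic bound applies. *)
Lemma penalized_mle_tail (R : realType) (dsp : measure_display) (T : measurableType dsp)
  (P : probability T R) (d : nat) (h : R -> 'cV[R]_d)
  (h_meas : forall i : 'I_d, measurable_fun [set: R] (fun x => h x i 0))
  (g1 g2 : R -> R) (G1 G2 : probability (measurableTypeR R) R)
  (g1_density : is_density g1 G1) (g2_density : is_density g2 G2)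
  (theta0 : 'cV[R]_(1 + d))
  (density_ratio : forall x, g1 x = expR (linpred h theta0 x) * g2 x)
  (m n : nat) (m0 : (0 < m)%N) (n0 : (0 < n)%N)
  (X1 : 'I_m -> {RV P >-> measurableTypeR R})
  (X2 : 'I_n -> {RV P >-> measurableTypeR R})
  (samples : two_samples G1 G2 X1 X2) (rho1 : R)
  (A_finite : finite_A_integrals h theta0 rho1 G2)
  (q lam L kappa K Lam : R) (thetahat : T -> 'cV[R]_(1 + d)) :
  0 < rho1 -> rho1 / 2 <= m%:R / n%:R -> m%:R / n%:R <= 2 * rho1 ->
  0 <= L ->
  (forall b : 'cV[R]_d,
    bridge_penalty q (slope theta0) - L * \sum_j `|b j 0 - slope theta0 j 0|
      <= bridge_penalty q b) ->
  0 < kappa ->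
  (forall u : 'cV[R]_(1 + d), kappa * (\sum_i `|u i 0|) ^+ 2
      <= \sum_i \sum_j u i 0 * u j 0 * \int[G2]_x info h theta0 i j x) ->
  0 < K -> 0 <= lam -> lam <= Lam * Num.sqrt (m + n)%:R ->
  measurable_vector thetahat ->
  (forall t, maximizer (penalized_loglik h q lam (fun j => X1 j t) (fun j => X2 j t))
     (thetahat t)) ->
  let c := rho1 / 2 / (1 + 2 * rho1) ^+ 3 * kappa in
  8 * (K + Lam * L) <= c * Num.sqrt (m + n)%:R ->
  (P [set t | (8 * (K + Lam * L) / c * (Num.sqrt (m + n)%:R)^-1
      < `|enorm (thetahat t - theta0)|)%R]
    <= (6 * (\sum_i matA h theta0 rho1 G2 i i) / K ^+ 2
        + (1 + d)%:R ^+ 2 * (4 / kappa ^+ 2 / n%:R))%:E)%E.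
Proof.
move=> rho10 rho_ge rho_le L0 penL kappa0 posM K0 lam0 lamle mtheta maxtheta c big.
set rho := m%:R / n%:R in rho_ge rho_le.
set N := (m + n)%:R : R; set sN := Num.sqrt N in lamle big *.
have n0R : 0 < n%:R :> R by rewrite ltr0n.
have N0 : 0 < N by rewrite /N natrD ltr_wpDl.
have sN0 : 0 < sN by rewrite sqrtr_gt0.
have sN2 : sN * sN = N by rewrite -expr2 sqr_sqrtr// ltW.
have rho0 : 0 < rho by apply: lt_le_trans rho_ge; rewrite divr_gt0.
have [KN0 NN0] : K != 0 /\ N != 0 by rewrite !gt_eqF.
have [kN0 nN0] : kappa != 0 /\ n%:R != 0 :> R by rewrite !gt_eqF.
have mE : m%:R = rho * n%:R :> R by rewrite /rho divfK// gt_eqF.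
have NE : N = (1 + rho) * n%:R by rewrite /N natrD mE; ring.
have mX1 j : measurable_fun [set: T] (X1 j) by exact: measurable_funP.
have mX2 j : measurable_fun [set: T] (X2 j) by exact: measurable_funP.
pose bad1 (i : 'I_(1 + d)) : set T :=
  [set t | K * sN <= `|score h (fun j => X1 j t) (fun j => X2 j t) theta0 i|].
pose bad2 (ij : 'I_(1 + d) * 'I_(1 + d)) : set T :=
  [set t | n%:R * (kappa / 2) <= `|\sum_(k < n) info h theta0 ij.1 ij.2 (X2 k t)
      - n%:R * \int[G2]_x info h theta0 ij.1 ij.2 x|].
have mbad1 i : measurable (bad1 i).
  apply: measurable_ge; apply: measurableT_comp => //.
  exact: (@measurable_score _ _ _ _ _ _ _ (fun t j => X1 j t) (fun t j => X2 j t)).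
have mbad2 ij : measurable (bad2 ij).
  apply: measurable_ge; apply: measurableT_comp => //; apply: measurable_funB => //.
  apply: measurable_sum => k.
  exact: (measurableT_comp (measurable_info h_meas theta0 ij.1 ij.2) (mX2 k)).
have KsN0 : 0 < K * sN by rewrite mulr_gt0.
have rho1le : rho1 <= 2 * rho by rewrite mulrC -ler_pdivrMr.
have Pbad1 i : (P (bad1 i) <= (6 * matA h theta0 rho1 G2 i i / K ^+ 2)%:E)%E.
  apply: le_trans (score_tail h_meas g1_density g2_density density_ratio m0 n0
    samples i rho10 rho1le A_finite KsN0) _.
  have A0 : 0 <= matA h theta0 rho1 G2 i i.
    rewrite matAE; apply: Rintegral_ge0 => x _; rewrite mulr_ge0 -?expr2 ?sqr_ge0//.
    have e0 := expR_gt0 (linpred h theta0 x).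
    by rewrite divr_ge0 ?ltW// addr_gt0// mulr_gt0.
  rewrite lee_fin exprMn [sN ^+ 2]expr2 sN2.
  rewrite (_ : _ / _ = (6 * matA h theta0 rho1 G2 i i / K ^+ 2) * (m%:R / N)); last first.
    by field; rewrite -natrD -/N NN0 KN0.
  rewrite ler_piMr//; first by rewrite divr_ge0 ?sqr_ge0// mulr_ge0.
  by rewrite ler_pdivrMr// mul1r /N natrD lerDl ltW.
have nk0 : 0 < n%:R * (kappa / 2) by rewrite mulr_gt0// divr_gt0.
have Pbad2 ij : (P (bad2 ij) <= (4 / kappa ^+ 2 / n%:R)%:E)%E.
  apply: le_trans (info_tail h_meas theta0 samples ij.1 ij.2 nk0) _.
  rewrite lee_fin le_eqVlt; apply/orP; left; apply/eqP.
  by field; rewrite kN0 nN0.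
have [mU1 PU1] := union_bound P mbad1.
have [mU2 PU2] := union_bound P mbad2.
set U1 := [set t | exists i, bad1 i t] in mU1 PU1.
set U2 := [set t | exists i, bad2 i t] in mU2 PU2.
have enormE t : `|enorm (thetahat t - theta0)| = enorm (thetahat t - theta0).
  by rewrite ger0_norm// sqrtr_ge0.
apply: (@le_trans _ _ (P (U1 `|` U2))).
  apply: le_measure; rewrite ?inE.
  - under eq_set do rewrite enormE.
    by apply: measurable_gt; exact: measurable_enorm.
  - exact: measurableU.
  move=> t /=; rewrite enormE => far; apply: contrapT => /not_orP[notU1 notU2].
  have scS i : `|score h (fun j => X1 j t) (fun j => X2 j t) theta0 i| <= K * sN.
    by rewrite leNgt; apply/negP => /ltW b; apply: notU1; exists i.
  have infoS i j : `|\sum_k info h theta0 i j (X2 k t) - n%:R * \int[G2]_x info h theta0 i j x|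
      <= n%:R * (kappa / 2).
    by rewrite leNgt; apply/negP => /ltW b; apply: notU2; exists (i, j).
  have := rate_bound m0 n0 lam0 L0 penL posM scS infoS (maxtheta t theta0).
  rewrite -/rho; set r := \sum_i `|_| => bound.
  have r0 : 0 <= r by exact: sumr_ge0.
  have er : enorm (thetahat t - theta0) <= r.
    apply: le_trans (enorm_le_sum _) _; rewrite /r le_eqVlt; apply/orP; left; apply/eqP.
    by apply: eq_bigr => i _; rewrite !mxE.
  have SB : K * sN + lam * L <= (K + Lam * L) * sN.
    rewrite mulrDl lerD2l -mulrA [L * sN]mulrC mulrA.
    by rewrite ler_wpM2r.
  have sN2' : sN * sN = (1 + rho) * n%:R by rewrite sN2.
  have rle := solve_rate_inequality rho10 rho_ge rho_le n0R kappa0 sN0 sN2' r0 SB bound big.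
  by move: (le_lt_trans rle far); rewrite ltNge er.
apply: le_trans (measureU2 _ mU1 mU2) _.
rewrite EFinD leeD//.
  apply: (le_trans PU1); apply: (@le_trans _ _ (\sum_i (6 * matA h theta0 rho1 G2 i i / K ^+ 2)%:E)%E).
    by apply: lee_sum => i _; exact: Pbad1.
  by rewrite sumEFin lee_fin -big_distrl -big_distrr.
apply: (le_trans PU2); apply: (@le_trans _ _ (\sum_(ij : 'I_(1 + d) * 'I_(1 + d)) (4 / kappa ^+ 2 / n%:R)%:E)%E).
  by apply: lee_sum => ij _; exact: Pbad2.
by rewrite sumEFin lee_fin sumr_const card_prod !card_ord -[leLHS]mulr_natl natrM expr2.
Qed.

(** * Root-n rate of the penalized estimator *)

Unset Implicit Arguments.

Theorem theorem3p1 (R : realType) (dsp : measure_display)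
  (T : measurableType dsp) (P : probability T R)
  (d : nat) (h : R -> 'cV[R]_d)
  (h_meas : forall i : 'I_d, measurable_fun [set: R] (fun x => h x i 0))
  (g1 g2 : R -> R) (G1 G2 : probability (measurableTypeR R) R)
  (g1_density : is_density g1 G1) (g2_density : is_density g2 G2)
  (theta0 : 'cV[R]_(1 + d))
  (density_ratio : forall x, g1 x = expR (linpred h theta0 x) * g2 x)
  (Theta : set 'cV[R]_(1 + d)) (Theta_compact : compact Theta)
  (theta0_in : Theta theta0)
  (n1 n2 : nat -> nat)
  (n1_pos : forall k, (0 < n1 k)%N) (n2_pos : forall k, (0 < n2 k)%N)
  (n_infty : (n1 k + n2 k)%N @[k --> \oo] --> \oo)
  (rho1 : R) (rho1_pos : 0 < rho1)
  (ratio_cvg : ((n1 k)%:R / (n2 k)%:R : R) @[k --> \oo] --> rho1)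
  (X1 : forall k, 'I_(n1 k) -> {RV P >-> measurableTypeR R})
  (X2 : forall k, 'I_(n2 k) -> {RV P >-> measurableTypeR R})
  (samples : forall k, two_samples G1 G2 (X1 k) (X2 k))
  (A_finite : finite_A_integrals h theta0 rho1 G2)
  (A_nonsingular : matA h theta0 rho1 G2 \in unitmx)
  (q : R) (q_gt1 : 1 < q)
  (lam : nat -> R) (lam_pos : forall k, 0 < lam k)
  (lam0 : R) (lam0_ge0 : 0 <= lam0)
  (lam_cvg : lam k / Num.sqrt (n1 k + n2 k)%:R @[k --> \oo] --> lam0) :
  exists thetahat : nat -> T -> 'cV[R]_(1 + d),
    [/\ forall k, measurable_vector (thetahat k),
        forall k (t : T),
          unique
            (maximizer (penalized_loglik h q (lam k)
               (fun j => X1 k j t) (fun j => X2 k j t)))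
            (thetahat k t),
        bigO_in_probability P (fun k t => enorm (thetahat k t - theta0))
          (fun k => (Num.sqrt (n1 k + n2 k)%:R)^-1) &
        lam0 = 0 -> consistent P thetahat theta0].
Proof.
have mle k t := @penalized_mle_exists _ _ h q (lam k) _ _ (fun j => X1 k j t)
  (fun j => X2 k j t) (n1_pos k) (n2_pos k) q_gt1 (lam_pos k).
pose thetahat k t := projT1 (cid (mle k t)).
have thetahatP k t : unique (maximizer (penalized_loglik h q (lam k)
    (fun j => X1 k j t) (fun j => X2 k j t))) (thetahat k t).
  exact: (projT2 (cid (mle k t))).
have mtheta k : measurable_vector (thetahat k).
  apply: (@measurable_argmax R dsp T _ (fun t => penalized_loglik h q (lam k)
    (fun j => X1 k j t) (fun j => X2 k j t))) => // [v|t|t].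
  - have mX1 j : measurable_fun [set: T] (X1 k j) by exact: measurable_funP.
    have mX2 j : measurable_fun [set: T] (X2 k j) by exact: measurable_funP.
    exact: (@measurable_penalized_loglik _ _ _ _ h q (lam k) _ _
      (fun t j => X1 k j t) (fun t j => X2 k j t)).
  - exact: continuous_penalized_loglik.
  - exact: coercive_penalized_loglik.
have N_infty (b : R) : \forall k \near \oo, b <= (n1 k + n2 k)%:R.
  exact: (n_infty _ (nbhs_infty_ger b)).
have sqrtN_infty (b : R) : \forall k \near \oo, b <= Num.sqrt (n1 k + n2 k)%:R.
  apply: filterS (N_infty (b ^+ 2)) => k bN.
  by rewrite (le_trans (ler_norm b))// -sqrtr_sqr ler_wsqrtr.
have rate : bigO_in_probability P (fun k t => enorm (thetahat k t - theta0))
    (fun k => (Num.sqrt (n1 k + n2 k)%:R)^-1).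
  move=> eps eps0.
  have [kappa kappa0 posM] := info_positive_definite h_meas A_finite A_nonsingular.
  have [L L0 penL] := bridge_penalty_lower (slope theta0) q_gt1.
  (* The score contributes W / K^2 to the probability of the bad event, and the
     empirical matrix contributes D / n2; each is made at most eps / 2. *)
  pose W := 6 * \sum_i matA h theta0 rho1 G2 i i.
  pose K := Num.sqrt (2 * `|W| / eps) + 1.
  have K0 : 0 < K by rewrite ltr_wpDl ?sqrtr_ge0.
  have WK : W / K ^+ 2 <= eps / 2.
    rewrite ler_pdivrMr ?exprn_gt0// (le_trans (ler_norm W))//.
    have : 2 * `|W| / eps <= K ^+ 2.
      have W0 : 0 <= 2 * `|W| / eps by rewrite divr_ge0 ?mulr_ge0// ltW.
      rewrite -[leLHS]sqr_sqrtr// lerXn2r ?nnegrE ?sqrtr_ge0 ?(ltW K0)//.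
      by rewrite lerDl.
    rewrite ler_pdivrMr// => H; rewrite mulrAC ler_pdivlMr//; lra.
  pose Lam := lam0 + 1.
  pose c := rho1 / 2 / (1 + 2 * rho1) ^+ 3 * kappa.
  have c0 : 0 < c by rewrite /c mulr_gt0// divr_gt0 ?divr_gt0// exprn_gt0// addr_gt0// mulr_gt0.
  have B0 : 0 < K + Lam * L by rewrite ltr_pwDl// mulr_ge0// addr_ge0.
  exists (8 * (K + Lam * L) / c); first by rewrite divr_gt0// mulr_gt0.
  have rho_near : \forall k \near \oo, rho1 / 2 <= (n1 k)%:R / (n2 k)%:R <= 2 * rho1.
    have rho1h : 0 < rho1 / 2 by rewrite divr_gt0.
    move/cvgrPdist_lt: ratio_cvg => /(_ _ rho1h); apply: filterS => k.
    by rewrite ltr_norml => /andP[? ?]; apply/andP; split; lra.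
  have lam_near : \forall k \near \oo, lam k <= Lam * Num.sqrt (n1 k + n2 k)%:R.
    move/cvgrPdist_lt: lam_cvg => /(_ _ ltr01); apply: filterS => k.
    rewrite ltr_norml => /andP[lo _].
    rewrite -ler_pdivrMr ?sqrtr_gt0 ?ltr0n ?addn_gt0 ?n1_pos// /Lam; lra.
  pose D := (1 + d)%:R ^+ 2 * (4 / kappa ^+ 2) : R.
  have D0 : 0 <= D by rewrite mulr_ge0 ?sqr_ge0// divr_ge0 ?sqr_ge0.
  near=> k.
  have /andP[rho_ge rho_le] : rho1 / 2 <= (n1 k)%:R / (n2 k)%:R <= 2 * rho1 by near: k.
  have lamk : lam k <= Lam * Num.sqrt (n1 k + n2 k)%:R by near: k.
  have big : 8 * (K + Lam * L) <= c * Num.sqrt (n1 k + n2 k)%:R.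
    rewrite [leRHS]mulrC -ler_pdivrMr//.
    by near: k; exact: sqrtN_infty.
  have n2big : 2 * D / eps <= (n2 k)%:R.
    have : (1 + 2 * rho1) * (2 * D / eps) <= (n1 k + n2 k)%:R by near: k; exact: N_infty.
    move: rho_le; rewrite natrD ler_pdivrMr ?ltr0n// => rho_le NE.
    have p2 : 0 < 1 + 2 * rho1 by rewrite addr_gt0// mulr_gt0.
    rewrite -(ler_pM2l p2) (le_trans NE)// mulrDl mul1r addrC.
    by rewrite lerD2l.
  have := penalized_mle_tail h_meas g1_density g2_density density_ratio (n1_pos k) (n2_pos k)
    (samples k) A_finite rho1_pos rho_ge rho_le L0 penL kappa0 posM K0 (ltW (lam_pos k)) lamk
    (mtheta k) (fun t => (thetahatP k t).1) big.
  move=> /le_trans; apply; rewrite lee_fin.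
  have DE : (1 + d)%:R ^+ 2 * (4 / kappa ^+ 2 / (n2 k)%:R) <= eps / 2.
    rewrite [_ / (n2 k)%:R]mulrC mulrCA -/D mulrC ler_pdivrMr ?ltr0n//.
    by move: n2big; rewrite ler_pdivrMr// => n2big; rewrite mulrAC ler_pdivlMr//; lra.
  by rewrite (splitr eps) lerD.
exists thetahat; split => // _.
apply: (bigO_in_probability_consistent mtheta _ rate).
apply/cvgrPdist_le => e e0.
apply: filterS (sqrtN_infty e^-1) => k ek.
rewrite sub0r normrN ger0_norm ?invr_ge0 ?sqrtr_ge0//.
by rewrite -[leRHS]invrK lef_pV2 ?posrE ?invr_gt0// sqrtr_gt0 ltr0n addn_gt0 n1_pos.
Unshelve. all: end_near. Qed.
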